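(* Consider the generalized Riemann problem described in the context, with the local wave configuration described there, whose right wave is a shock wave associated with $\lambda_+$ moving to the right with initial speed $s_*>0$. Then the limiting values $\left(\frac{\partial\rho}{\partial t}\right)_*$ and $\left(\frac{\partial v}{\partial t}\right)_*$ satisfy $$a_R\left(\frac{\partial\rho}{\partial t}\right)_*+b_R\left(\frac{\partial v}{\partial t}\right)_*=d_R,$$ where $$a_R=\Phi_\rho(\rho_*,\rho_R)\left(v^2-c_s^2-\frac{sv(1-c_s^2)}{\sqrt{AB}}\right)_*+\frac{v_R^2-1}{(1-v_*v_R)^2}\left(\frac{s(1-v^2)^2c_s^2}{\sqrt{AB}(\rho+p)}\right)_*,$$ $$b_R=\Phi_\rho(\rho_*,\rho_R)\frac{s_*(\rho_*+p_* )}{\sqrt{A_*B_*}}+\frac{v_R^2-1}{(1-v_*v_R)^2}\left(v^2-c_s^2-\frac{sv(1-c_s^2)}{\sqrt{AB}}\right)_*,$$ $$\begin{aligned}d_R=&\ \Phi_\rho(\rho_*,\rho_R)(\Pi_1)_*+\frac{v_R^2-1}{(1-v_*v_R)^2}(\Pi_2)_*\\&+(v^2-c_s^2)_*\left[\frac{v_*^2-1}{(1-v_*v_R)^2}\left(\frac{D_sv}{Dt}\right)_R-\Phi_{\bar\rho}(\rho_*,\rho_R)\left(\frac{D_s\rho}{Dt}\right)_R\right].\end{aligned}$$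
   Context: **Equations.** Units are such that the speed of light and Newton's constant equal $1$; $\kappa$ is the (constant) Einstein coupling constant. The fluid has rest energy density $\rho>0$, velocity $v\in(-1,1)$ and pressure $p=p(\rho)\ge0$, where $p$ is a sufficiently smooth function with $0<p'(\rho)<1$ and $p''(\rho)>-\frac{2p'(\rho)(1-p'(\rho))}{\rho+p(\rho)}$ (genuine nonlinearity of both characteristic fields); $c_s=\sqrt{p'(\rho)}$ and $W=1/\sqrt{1-v^2}$. The metric functions $A(t,r)>0$, $B(t,r)>0$ are locally Lipschitz continuous. With $\mathcal T^{00}=(\rho+p)W^2-p$, $\mathcal T^{01}=(\rho+p)W^2v$, $\mathcal T^{11}=(\rho v^2+p)W^2$, $\mathbf U=(\mathcal T^{00},\mathcal T^{01})^{T}$, $\mathbf F(\mathbf U)=(\mathcal T^{01},\mathcal T^{11})^{T}$, the spherically symmetric general relativistic hydrodynamics system is $$\partial_t\mathbf U+\partial_r\big(\sqrt{AB}\,\mathbf F(\mathbf U)\big)=\mathbf S,\quad \partial_rM=\tfrac12\kappa r^2\mathcal T^{00},\quad \frac1B\partial_rB=\frac{1-A}{Ar}+\frac{\kappa r}{A}\mathcal T^{11},\quad A=1-\frac{2M}{r},$$ $$\mathbf S=-\sqrt{AB}\Big(\tfrac2r\mathcal T^{01},\ \tfrac2r\mathcal T^{11}+\tfrac{1-A}{2Ar}(\mathcal T^{00}-\mathcal T^{11})+\tfrac{\kappa r}{A}\big(\mathcal T^{00}\mathcal T^{11}-(\mathcal T^{01})^2\big)-\tfrac{2p}{r}\Big)^{T}.$$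 In smooth regions, $\mathbf V=(\rho,v)^T$ satisfies $\partial_t\mathbf V+\mathbf J\,\partial_r\mathbf V=\mathbf H=(H_1,H_2)^T$, where $$\mathbf J=\frac{\sqrt{AB}}{1-v^2c_s^2}\begin{pmatrix}v(1-c_s^2)&\rho+p\\ \frac{(1-v^2)^2c_s^2}{\rho+p}&v(1-c_s^2)\end{pmatrix},$$ $$H_1=-\frac{\sqrt{AB}}{r(1-v^2c_s^2)}\,2v(\rho+p)\Big(1-\frac{\kappa r^2(\rho+p)}{4A}\Big),$$ $$H_2=-\frac{\sqrt{AB}\,(1-v^2)}{r(1-v^2c_s^2)}\Big(-2v^2c_s^2+\frac{(1-A)(1-v^2c_s^2)}{2A}+\frac{\kappa r^2(p+\rho v^2c_s^2)}{2A}\Big).$$ The characteristic speeds are $\lambda_\pm=\sqrt{AB}\,\frac{v\pm c_s}{1\pm vc_s}$. **Generalized Riemann problem (GRP) and wave configuration.** Fix $r_0>0$ and constant vectors $\mathbf U_L,\mathbf U_R,\mathbf U_L',\mathbf U_R'$. The initial data are $\mathbf U(0,r)=\mathbf U_L+(r-r_0)\mathbf U_L'$ for $r<r_0$ and $\mathbf U_R+(r-r_0)\mathbf U_R'$ for $r>r_0$. For small $t>0$ the GRP solution consists of a smooth left region, a curved rarefaction wave associated with $\lambda_-$ centered at $(0,r_0)$, a smooth intermediate region (state $\mathbf U_*(t,r)$) containing the line $r=r_0$, a shock $r=r_s(t)$ associated with the $\lambda_+$-field with speed $s=r_s'(t)>0$, $r_s(0)=r_0$, and a smooth right region (state $\mathbf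 U_R(t,r)$). For a quantity $V$ (a state variable or one of its derivatives), $V_R$ is its limit at $(0,r_0)$ as $t\to0^+$ from the right region and $V_*$ its limit as $t\to0^+$ from the intermediate region; $s_*=r_s'(0)$, and $A$, $B$, $r$ take the values $A_*=A(0,r_0)$, $B_*=B(0,r_0)$, $r_0$ in these limits. **Shock.** Along the shock let $\mathbf U(t)=\mathbf U(t,r_s(t)-0)$ (quantities without bar) and $\overline{\mathbf U}(t)=\mathbf U(t,r_s(t)+0)$ (quantities with bar). Then the Rankine–Hugoniot relation $[\sqrt{AB}\,\mathbf F(\mathbf U)]=s[\mathbf U]$ holds, with $[\cdot]$ the jump across the shock, and the shock satisfies the Lax entropy condition; $A,B$ are continuous across it. These give $$\frac{v-\bar v}{1-v\bar v}=\Phi(\rho,\bar\rho),\qquad \Phi(\rho,\bar\rho):=\sqrt{\frac{(p-\bar p)(\rho-\bar\rho)}{(\rho+\bar p)(\bar\rho+p)}},\qquad p=p(\rho),\ \bar p=p(\bar\rho).$$ The partial derivatives of $\Phi$ are, with $\Delta_{\rho,\bar\rho}:=\sqrt{(p-\bar p)/(\rho-\bar\rho)}$ and $\bar c_s^2=p'(\bar\rho)$, $$\Phi_\rho(\rho,\bar\rho)=\frac{(\bar\rho+\bar p)\left(c_s^2\Delta_{\rho,\bar\rho}^{-1}(\rho+\bar p)+\Delta_{\rho,\bar\rho}(\bar\rho+p)\right)}{2\left((\rho+\bar p)(\bar\rho+p)\right)^{3/2}},\qquad \Phi_{\bar\rho}(\rho,\bar\rho)=-\frac{(\rho+p)\left(\bar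 c_s^2\Delta_{\rho,\bar\rho}^{-1}(\bar\rho+p)+\Delta_{\rho,\bar\rho}(\rho+\bar p)\right)}{2\left((\rho+\bar p)(\bar\rho+p)\right)^{3/2}}.$$ The directional derivative along the shock is $\frac{D_s}{Dt}=\partial_t+s\,\partial_r$; $\left(\frac{D_sv}{Dt}\right)_R$, $\left(\frac{D_s\rho}{Dt}\right)_R$ are its limits from the right region (with $s=s_*$). Finally $$\Pi_1=\frac sr(\rho+p)\Big(2v^2-\frac{(1-A)(1-v^2)}{2A}-\frac{\kappa r^2(p+\rho v^2)}{2A}\Big),$$ $$\Pi_2=\frac sr\,v(v^2-1)\Big(2c_s^2-\frac{(1-A)(1-c_s^2)}{2A}-\frac{\kappa r^2(p+\rho c_s^2)}{2A}\Big).$$ *)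

(* Defs.v *)
From Stdlib Require Export Reals.
From Coquelicot Require Export Coquelicot.
Open Scope R_scope.

(* Space-time fields are functions f t r, with time first. *)

(** * Fluid *)

Record equation_of_state (p : R -> R) : Prop := {
  eos_diff : forall rho k, 0 < rho -> (k <= 2)%nat -> ex_derive_n p k rho;
  eos_C2 : forall rho, 0 < rho -> continuous (Derive_n p 2) rho;
  eos_nonneg : forall rho, 0 < rho -> 0 <= p rho;
  eos_causal : forall rho, 0 < rho -> 0 < Derive p rho < 1;
  eos_nonlinear : forall rho, 0 < rho ->
    Derive_n p 2 rho
      > - (2 * Derive p rho * (1 - Derive p rho) / (rho + p rho))
}.

Definition admissible (rho v : R) : Prop := 0 < rho /\ -1 < v < 1.

Definition cs (p : R -> R) (rho : R) : R := sqrt (Derive p rho).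

Definition W (v : R) : R := 1 / sqrt (1 - v ^ 2).

Definition T00 (p : R -> R) (rho v : R) : R := (rho + p rho) * W v ^ 2 - p rho.
Definition T01 (p : R -> R) (rho v : R) : R := (rho + p rho) * W v ^ 2 * v.
Definition T11 (p : R -> R) (rho v : R) : R := (rho * v ^ 2 + p rho) * W v ^ 2.

(* In the next two definitions A and B are the values of the metric functions. *)
Definition lambda_plus (p : R -> R) (A B rho v : R) : R :=
  sqrt (A * B) * ((v + cs p rho) / (1 + v * cs p rho)).
Definition lambda_minus (p : R -> R) (A B rho v : R) : R :=
  sqrt (A * B) * ((v - cs p rho) / (1 - v * cs p rho)).

(** * The Einstein-Euler system in spherical symmetry *)

Definition S0 (p : R -> R) (A B r rho v : R) : R :=
  - sqrt (A * B) * (2 / r * T01 p rho v).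
Definition S1 (kappa : R) (p : R -> R) (A B r rho v : R) : R :=
  - sqrt (A * B) *
  (2 / r * T11 p rho v
   + (1 - A) / (2 * A * r) * (T00 p rho v - T11 p rho v)
   + kappa * r / A * (T00 p rho v * T11 p rho v - T01 p rho v ^ 2)
   - 2 * p rho / r).

(* A = 1 - 2 M / r is imposed on the whole domain in [GRP_solution]. *)
Record einstein_euler_at (kappa : R) (p : R -> R) (A B M rho v : R -> R -> R)
    (t r : R) : Prop := {
  ee_energy :
    Derive (fun t' => T00 p (rho t' r) (v t' r)) t
    + Derive (fun r' => sqrt (A t r' * B t r') * T01 p (rho t r') (v t r')) r
    = S0 p (A t r) (B t r) r (rho t r) (v t r);
  ee_momentum :
    Derive (fun t' => T01 p (rho t' r) (v t' r)) t
    + Derive (fun r' => sqrt (A t r' * B t r') * T11 p (rho t r') (v t r')) r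
    = S1 kappa p (A t r) (B t r) r (rho t r) (v t r);
  ee_M_diff : ex_derive (M t) r;
  ee_M : Derive (M t) r = 1 / 2 * kappa * r ^ 2 * T00 p (rho t r) (v t r);
  ee_B_diff : ex_derive (B t) r;
  ee_B :
    1 / B t r * Derive (B t) r
    = (1 - A t r) / (A t r * r)
      + kappa * r / A t r * T11 p (rho t r) (v t r)
}.

(** * Regularity *)

Definition locally_lipschitz_on (D : R -> R -> Prop) (f : R -> R -> R) : Prop :=
  forall t r, D t r ->
  exists K eps, 0 < eps /\
    forall t1 r1 t2 r2, D t1 r1 -> D t2 r2 ->
      Rabs (t1 - t) < eps -> Rabs (r1 - r) < eps ->
      Rabs (t2 - t) < eps -> Rabs (r2 - r) < eps ->
      Rabs (f t1 r1 - f t2 r2) <= K * (Rabs (t1 - t2) + Rabs (r1 - r2)).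

Definition d_t (f : R -> R -> R) (t r : R) : R := Derive (fun t' => f t' r) t.
Definition d_r (f : R -> R -> R) (t r : R) : R := Derive (f t) r.

Definition C1_at (f : R -> R -> R) (t r : R) : Prop :=
  ex_derive (fun t' => f t' r) t /\ ex_derive (f t) r /\
  continuity_2d_pt f t r /\
  continuity_2d_pt (d_t f) t r /\ continuity_2d_pt (d_r f) t r.

Record smooth_region (kappa : R) (p : R -> R) (A B M rho v : R -> R -> R)
    (D : R -> R -> Prop) : Prop := {
  sr_adm : forall t r, D t r -> admissible (rho t r) (v t r);
  sr_rho : forall t r, D t r -> C1_at rho t r;
  sr_v : forall t r, D t r -> C1_at v t r;
  sr_eq : forall t r, D t r -> einstein_euler_at kappa p A B M rho v t r
}.

(* Limit of f at the point (t0, r0), approached from inside D. *)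
Definition limit_from (D : R -> R -> Prop) (t0 r0 : R) (f : R -> R -> R) (l : R)
  : Prop :=
  filterlim (fun z : R * R => f (fst z) (snd z))
    (within (fun z : R * R => D (fst z) (snd z)) (locally (t0, r0)))
    (locally l).

(* Limits at (0, r0), from one region, of the state and its first derivatives. *)
Record jet := Jet {
  j_rho : R; j_v : R;
  j_rho_t : R; j_rho_r : R;
  j_v_t : R; j_v_r : R
}.

Record corner_limits (r0 : R) (D : R -> R -> Prop) (rho v : R -> R -> R)
    (j : jet) : Prop := {
  cl_adm : admissible (j_rho j) (j_v j);
  cl_rho : limit_from D 0 r0 rho (j_rho j);
  cl_v : limit_from D 0 r0 v (j_v j);
  cl_rho_t : limit_from D 0 r0 (d_t rho) (j_rho_t j);
  cl_rho_r : limit_from D 0 r0 (d_r rho) (j_rho_r j);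
  cl_v_t : limit_from D 0 r0 (d_t v) (j_v_t j);
  cl_v_r : limit_from D 0 r0 (d_r v) (j_v_r j)
}.

(* Limits at (0, r0) of D_s rho / Dt and D_s v / Dt, D_s / Dt = d_t + s d_r. *)
Definition Ds_rho (s : R) (j : jet) : R := j_rho_t j + s * j_rho_r j.
Definition Ds_v (s : R) (j : jet) : R := j_v_t j + s * j_v_r j.

(** * Waves *)

(* Centered rarefaction fan of the lambda_minus-field: X beta is the
   lambda_minus-characteristic issuing from (0, r0) with initial slope beta,
   for beta between bL (head of the fan) and bS (tail of the fan). *)
Record rarefaction_minus (kappa : R) (p : R -> R) (A B M rho v : R -> R -> R)
    (r0 T bL bS : R) (X : R -> R -> R) : Prop := {
  rf_slopes : bL < bS;
  rf_center : forall beta, bL <= beta <= bS ->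
    X beta 0 = r0 /\ filterlim (X beta) (at_right 0) (locally r0);
  rf_char : forall beta t, bL <= beta <= bS -> 0 < t < T ->
    is_derive (X beta) t
      (lambda_minus p (A t (X beta t)) (B t (X beta t))
         (rho t (X beta t)) (v t (X beta t)));
  rf_incr : forall beta beta' t, bL <= beta -> beta < beta' -> beta' <= bS ->
    0 < t < T -> X beta t < X beta' t;
  rf_cover : forall t r, 0 < t < T -> X bL t <= r <= X bS t ->
    exists beta, bL <= beta <= bS /\ X beta t = r;
  rf_limit : forall beta, bL <= beta <= bS ->
    exists rho0 v0, admissible rho0 v0 /\
      filterlim (fun t => rho t (X beta t)) (at_right 0) (locally rho0) /\
      filterlim (fun t => v t (X beta t)) (at_right 0) (locally v0) /\
      lambda_minus p (A 0 r0) (B 0 r0) rho0 v0 = beta;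
  rf_smooth : smooth_region kappa p A B M rho v
    (fun t r => 0 < t < T /\ X bL t < r < X bS t);
  rf_edges : forall t, 0 < t < T ->
    admissible (rho t (X bL t)) (v t (X bL t)) /\
    admissible (rho t (X bS t)) (v t (X bS t)) /\
    continuity_2d_pt rho t (X bL t) /\ continuity_2d_pt v t (X bL t) /\
    continuity_2d_pt rho t (X bS t) /\ continuity_2d_pt v t (X bS t)
}.

(* (rhol, vl) is the state just behind the shock, on its left (no bar), and
   (rhor, vr) the state just ahead of it, on its right (bar).  At t = 0 these
   are the limits at (0, r0) from the regions on either side; the
   Rankine-Hugoniot and Lax conditions hold up to and including t = 0. *)
Record shock_plus (p : R -> R) (A B rho v : R -> R -> R) (r0 T : R)
    (jS jR : jet) (rs s rhol vl rhor vr : R -> R) : Prop := {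
  sh_start : rs 0 = r0 /\ filterlim rs (at_right 0) (locally r0);
  sh_speed : forall t, 0 < t < T -> is_derive rs t (s t) /\ continuous s t;
  (* makes s 0 the one-sided derivative of rs at 0 *)
  sh_speed0 : filterlim s (at_right 0) (locally (s 0));
  sh_right : forall t, 0 <= t < T -> 0 < s t;
  sh_traces : forall t, 0 < t < T ->
    filterlim (rho t) (at_left (rs t)) (locally (rhol t)) /\
    filterlim (v t) (at_left (rs t)) (locally (vl t)) /\
    filterlim (rho t) (at_right (rs t)) (locally (rhor t)) /\
    filterlim (v t) (at_right (rs t)) (locally (vr t));
  sh_traces0 : rhol 0 = j_rho jS /\ vl 0 = j_v jS /\
               rhor 0 = j_rho jR /\ vr 0 = j_v jR;
  sh_adm : forall t, 0 <= t < T ->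
    admissible (rhol t) (vl t) /\ admissible (rhor t) (vr t);
  sh_RH0 : forall t, 0 <= t < T ->
    sqrt (A t (rs t) * B t (rs t)) * T01 p (rhol t) (vl t)
      - sqrt (A t (rs t) * B t (rs t)) * T01 p (rhor t) (vr t)
    = s t * (T00 p (rhol t) (vl t) - T00 p (rhor t) (vr t));
  sh_RH1 : forall t, 0 <= t < T ->
    sqrt (A t (rs t) * B t (rs t)) * T11 p (rhol t) (vl t)
      - sqrt (A t (rs t) * B t (rs t)) * T11 p (rhor t) (vr t)
    = s t * (T01 p (rhol t) (vl t) - T01 p (rhor t) (vr t));
  sh_Lax : forall t, 0 <= t < T ->
    lambda_plus p (A t (rs t)) (B t (rs t)) (rhor t) (vr t) < s t /\
    s t < lambda_plus p (A t (rs t)) (B t (rs t)) (rhol t) (vl t) /\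
    lambda_minus p (A t (rs t)) (B t (rs t)) (rhol t) (vl t) < s t
}.

(** * Generalized Riemann problem *)

Definition linear_data (p : R -> R) (U U' : R * R) (r0 r rho v : R) : Prop :=
  T00 p rho v = fst U + (r - r0) * fst U' /\
  T01 p rho v = snd U + (r - r0) * snd U'.

(* Solution on 0 <= t < T, |r - r0| < delta.  From left to right: left region,
   lambda_minus-rarefaction, intermediate region (containing the line r = r0),
   lambda_plus-shock r = rs t, right region; the jets jL, jS and jR collect the
   limits at (0, r0) from the three smooth regions. *)
Record GRP_solution (kappa : R) (p : R -> R) (A B M rho v : R -> R -> R)
    (r0 T delta : R) (UL UR UL' UR' : R * R)
    (X : R -> R -> R) (rs s rhol vl rhor vr : R -> R)
    (jL jS jR : jet) : Prop := {
  (* fan speeds at (0, r0) *)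
  bL := lambda_minus p (A 0 r0) (B 0 r0) (j_rho jL) (j_v jL);
  bS := lambda_minus p (A 0 r0) (B 0 r0) (j_rho jS) (j_v jS);
  dom := fun t r => 0 <= t < T /\ Rabs (r - r0) < delta;
  left_reg := fun t r => 0 < t < T /\ r0 - delta < r < X bL t;
  mid_reg := fun t r => 0 < t < T /\ X bS t < r < rs t;
  right_reg := fun t r => 0 < t < T /\ rs t < r < r0 + delta;

  grp_T : 0 < T;
  grp_delta : 0 < delta < r0;

  grp_A_pos : forall t r, dom t r -> 0 < A t r;
  grp_B_pos : forall t r, dom t r -> 0 < B t r;
  grp_A_lip : locally_lipschitz_on dom A;
  grp_B_lip : locally_lipschitz_on dom B;
  grp_A : forall t r, dom t r -> A t r = 1 - 2 * M t r / r;

  grp_adm0 : forall r, Rabs (r - r0) < delta -> r <> r0 ->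
    admissible (rho 0 r) (v 0 r);
  grp_dataL : forall r, r0 - delta < r < r0 ->
    linear_data p UL UL' r0 r (rho 0 r) (v 0 r);
  grp_dataR : forall r, r0 < r < r0 + delta ->
    linear_data p UR UR' r0 r (rho 0 r) (v 0 r);
  grp_attained : forall r, Rabs (r - r0) < delta -> r <> r0 ->
    limit_from (fun t _ => 0 < t) 0 r rho (rho 0 r) /\
    limit_from (fun t _ => 0 < t) 0 r v (v 0 r);

  grp_order : forall t, 0 < t < T ->
    r0 - delta < X bL t /\ X bS t < r0 /\ r0 < rs t /\ rs t < r0 + delta;

  grp_left : smooth_region kappa p A B M rho v left_reg;
  grp_left_lim : corner_limits r0 left_reg rho v jL;
  grp_fan : rarefaction_minus kappa p A B M rho v r0 T bL bS X;
  grp_mid : smooth_region kappa p A B M rho v mid_reg;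
  grp_mid_lim : corner_limits r0 mid_reg rho v jS;
  grp_shock :
    shock_plus p A B rho v r0 T jS jR rs s rhol vl rhor vr;
  grp_right : smooth_region kappa p A B M rho v right_reg;
  grp_right_lim : corner_limits r0 right_reg rho v jR
}.

(** * Coefficients of the resolution at the shock *)

Definition Phi (p : R -> R) (rho rhob : R) : R :=
  sqrt ((p rho - p rhob) * (rho - rhob)
        / ((rho + p rhob) * (rhob + p rho))).

(* Partial derivatives of Phi.  With E = (rho + p rhob) * (rhob + p rho) and
   D = sqrt ((p rho - p rhob) / (rho - rhob)), they are equal, for
   rho <> rhob, to
     (rhob + p rhob) * (p' rho / D * (rho + p rhob) + D * (rhob + p rho))
       / (2 * E^(3/2))   and
     - (rho + p rho) * (p' rhob / D * (rhob + p rho) + D * (rho + p rhob))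
       / (2 * E^(3/2))
   when rho > rhob, and to the opposites when rho < rhob. *)
Definition Phi_rho (p : R -> R) (rho rhob : R) : R :=
  Derive (fun x => Phi p x rhob) rho.
Definition Phi_rhob (p : R -> R) (rho rhob : R) : R :=
  Derive (fun y => Phi p rho y) rhob.

Definition Pi1 (kappa : R) (p : R -> R) (s A r rho v : R) : R :=
  s / r * (rho + p rho) *
  (2 * v ^ 2 - (1 - A) * (1 - v ^ 2) / (2 * A)
   - kappa * r ^ 2 * (p rho + rho * v ^ 2) / (2 * A)).

Definition Pi2 (kappa : R) (p : R -> R) (s A r rho v : R) : R :=
  s / r * v * (v ^ 2 - 1) *
  (2 * cs p rho ^ 2 - (1 - A) * (1 - cs p rho ^ 2) / (2 * A)
   - kappa * r ^ 2 * (p rho + rho * cs p rho ^ 2) / (2 * A)).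

(* Main.v *)
Require Import Defs.
From Stdlib Require Import Lra Lia.

(** The theorem is one linear relation between the time derivatives behind the
    shock, and it arises by differentiating the algebraic shock relation along
    the shock and trading space derivatives for time derivatives.

    The Rankine-Hugoniot conditions, once the shock speed is eliminated, say
    that the squared relative velocity of the two states equals [Phi ^ 2].  To
    take the root with the right sign the shock must be compressive.  In the rest
    frame of the shock, let [m] be the common energy flux [T01] of the two
    states.  The Lax inequalities compare it with the fluxes at sonic speed:
    [- m] is above the sonic flux ahead of the shock and below the sonic flux
    behind it.  Genuine nonlinearity is exactly monotonicity of the sonic flux in the
    density, so the density jumps up across the shock; conservation of momentum
    then orders the velocities ([Lax_shock_relative_velocity]).

    The relation holds for all times up to and including [0].  The
    one-sided traces of density and velocity have one-sided time derivatives at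
    [0], equal to the limits of [d_t + s d_r] ([right_derivative_of_trace]).
    The trace at time [t] is reached along curves
    [r0 + th (rs - r0)] with [th] close to [1]: these stay inside
    the smooth region, where the mean value theorem applies, and
    [th] tends to [1] afterwards.  Differentiating the relation gives a linear
    equation between the two directional derivatives behind the shock and those
    ahead of it ([Hugoniot_differentiated]).

    Behind the shock, the Einstein-Euler equations express
    [(v ^ 2 - cs ^ 2) d_r] of density and velocity through time derivatives and
    sources, which are the [Pi1] and [Pi2] of the theorem; the form multiplied
    by [v ^ 2 - cs ^ 2] remains meaningful at a sonic point
    ([einstein_euler_resolved]).  These identities pass to the limit along
    [r = r0] ([corner_resolved]).  Multiplying the differentiated shock relation
    by [v ^ 2 - cs ^ 2] and substituting gives the result. *)

(** * Limits of real functions *)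

Lemma lim_const {T} (F : (T -> Prop) -> Prop) {FF : Filter F} (c : R) :
  filterlim (fun _ => c) F (locally c).
Proof. apply filterlim_const. Qed.

Lemma lim_plus {T} (F : (T -> Prop) -> Prop) {FF : Filter F} (f g : T -> R) (a b : R) :
  filterlim f F (locally a) -> filterlim g F (locally b) ->
  filterlim (fun x => f x + g x) F (locally (a + b)).
Proof.
  intros Hf Hg.
  exact (filterlim_comp_2 f g Rplus Hf Hg
    (filterlim_plus (K := R_AbsRing) (V := R_NormedModule) a b)).
Qed.

Lemma lim_mult {T} (F : (T -> Prop) -> Prop) {FF : Filter F} (f g : T -> R) (a b : R) :
  filterlim f F (locally a) -> filterlim g F (locally b) ->
  filterlim (fun x => f x * g x) F (locally (a * b)).
Proof.
  intros Hf Hg.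
  exact (filterlim_comp_2 f g Rmult Hf Hg (filterlim_mult (K := R_AbsRing) a b)).
Qed.

Lemma lim_comp {T} (F : (T -> Prop) -> Prop) {FF : Filter F} (f : T -> R) (h : R -> R) (a : R) :
  filterlim f F (locally a) -> continuous h a ->
  filterlim (fun x => h (f x)) F (locally (h a)).
Proof. intros Hf Hh. exact (filterlim_comp _ _ _ f h F _ _ Hf Hh). Qed.

Lemma lim_opp {T} (F : (T -> Prop) -> Prop) {FF : Filter F} (f : T -> R) (a : R) :
  filterlim f F (locally a) -> filterlim (fun x => - f x) F (locally (- a)).
Proof.
  intros Hf. apply (lim_comp F); trivial.
  apply (filterlim_opp (K := R_AbsRing) (V := R_NormedModule)).
Qed.

Lemma lim_minus {T} (F : (T -> Prop) -> Prop) {FF : Filter F} (f g : T -> R) (a b : R) :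
  filterlim f F (locally a) -> filterlim g F (locally b) ->
  filterlim (fun x => f x - g x) F (locally (a - b)).
Proof. intros Hf Hg. apply (lim_plus F); trivial. now apply (lim_opp F). Qed.

Lemma lim_pow {T} (F : (T -> Prop) -> Prop) {FF : Filter F} (f : T -> R) (a : R) (n : nat) :
  filterlim f F (locally a) -> filterlim (fun x => f x ^ n) F (locally (a ^ n)).
Proof.
  intros Hf; induction n as [|n IH]; simpl; [apply (lim_const F)|now apply (lim_mult F)].
Qed.

Lemma lim_inv {T} (F : (T -> Prop) -> Prop) {FF : Filter F} (f : T -> R) (a : R) :
  filterlim f F (locally a) -> a <> 0 -> filterlim (fun x => / f x) F (locally (/ a)).
Proof. intros Hf Ha. apply (lim_comp F); trivial. now apply continuous_Rinv. Qed.

Lemma lim_eq {T} (F : (T -> Prop) -> Prop) {FF : ProperFilter F} (f g : T -> R) (a b : R) :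
  F (fun x => f x = g x) ->
  filterlim f F (locally a) -> filterlim g F (locally b) -> a = b.
Proof.
  intros E Hf Hg. assert (FF' := Proper_StrongProper F FF).
  apply (filterlim_locally_unique (V := R_NormedModule) (F := F) g); trivial.
  exact (filterlim_ext_loc f g E Hf).
Qed.

Ltac lim F :=
  repeat match goal with
  | |- filterlim (fun _ => _ - _) _ _ => apply (lim_minus F)
  | |- filterlim (fun _ => _ + _) _ _ => apply (lim_plus F)
  | |- filterlim (fun _ => _ * _) _ _ => apply (lim_mult F)
  | |- filterlim (fun _ => - _) _ _ => apply (lim_opp F)
  | |- filterlim (fun _ => / _) _ _ => apply (lim_inv F)
  | |- filterlim (fun _ => _ ^ _) _ _ => apply (lim_pow F)
  | |- filterlim (fun _ => _) _ _ => apply (lim_const F)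
  end.

Lemma at_right_eps (u : R -> R) (l : R) :
  filterlim u (at_right 0) (locally l) ->
  forall eps, 0 < eps -> exists d, 0 < d /\
    forall t, 0 < t < d -> Rabs (u t - l) < eps.
Proof.
  intros H eps He.
  destruct (proj1 (filterlim_locally _ _) H (mkposreal eps He)) as [d Hd].
  exists d; split; [apply cond_pos|].
  intros t Ht. apply (Hd t); [|lra].
  change (Rabs (t - 0) < d). rewrite Rminus_0_r, Rabs_pos_eq; lra.
Qed.

Lemma limit_from_eps D t0 r0 f l :
  limit_from D t0 r0 f l ->
  forall eps, 0 < eps -> exists d, 0 < d /\
    forall t r, Rabs (t - t0) < d -> Rabs (r - r0) < d -> D t r ->
      Rabs (f t r - l) < eps.
Proof.
  intros H eps He.
  destruct (proj1 (filterlim_locally _ _) H (mkposreal eps He)) as [d Hd].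
  exists d; split; [apply cond_pos|].
  intros t r Ht Hr HD. apply (Hd (t, r)); [split; assumption | exact HD].
Qed.

Lemma limit_from_vertical (D : R -> R -> Prop) (f : R -> R -> R) (T r0 l : R) :
  0 < T -> (forall t, 0 < t < T -> D t r0) -> limit_from D 0 r0 f l ->
  filterlim (fun t => f t r0) (at_right 0) (locally l).
Proof.
  intros HT HD H. apply filterlim_locally; intros [eps He].
  destruct (limit_from_eps _ _ _ _ _ H eps He) as [d [Hd Hf]].
  assert (Hm : 0 < Rmin d T) by (apply Rmin_glb_lt; lra).
  exists (mkposreal _ Hm). intros t Ht Ht0.
  change (Rabs (t - 0) < Rmin d T) in Ht.
  assert (Ht' := Ht). rewrite Rminus_0_r, Rabs_pos_eq in Ht' by lra.
  generalize (Rmin_l d T) (Rmin_r d T); intros M1 M2.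
  apply (Hf t r0); [lra|rewrite Rminus_diag, Rabs_R0; lra|apply HD; lra].
Qed.

Lemma lipschitz_vertical (D : R -> R -> Prop) (f : R -> R -> R) (T r0 : R) :
  0 < T -> (forall t, 0 <= t < T -> D t r0) -> locally_lipschitz_on D f ->
  filterlim (fun t => f t r0) (at_right 0) (locally (f 0 r0)).
Proof.
  intros HT HD H.
  destruct (H 0 r0 (HD 0 ltac:(lra))) as [K [e [He HK]]].
  apply filterlim_locally; intros [eps Heps].
  set (K1 := Rabs K + 1). assert (HK1 : 0 < K1) by (unfold K1; generalize (Rabs_pos K); lra).
  assert (Hm : 0 < Rmin (Rmin e T) (eps / K1)).
  { repeat apply Rmin_glb_lt; try lra. now apply Rdiv_lt_0_compat. }
  exists (mkposreal _ Hm). intros t Ht Ht0.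
  change (Rabs (t - 0) < Rmin (Rmin e T) (eps / K1)) in Ht.
  rewrite Rminus_0_r, Rabs_pos_eq in Ht by lra.
  generalize (Rmin_l (Rmin e T) (eps / K1)) (Rmin_r (Rmin e T) (eps / K1))
    (Rmin_l e T) (Rmin_r e T); intros.
  change (Rabs (f t r0 - f 0 r0) < eps).
  assert (B := HK t r0 0 r0 (HD t ltac:(lra)) (HD 0 ltac:(lra))).
  rewrite !Rminus_diag, !Rabs_R0, Rminus_0_r, (Rabs_pos_eq t) in B by lra.
  specialize (B ltac:(lra) He ltac:(lra) He).
  assert (t * K1 < eps) by (apply Rlt_div_r; lra).
  generalize (Rle_abs K). unfold K1 in *. nra.
Qed.

(** * Monotonicity and mean value bounds *)

Lemma increasing_of_derive_pos (f df : R -> R) :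
  (forall x, 0 < x -> is_derive f x (df x) /\ 0 < df x) ->
  forall a b, 0 < a -> a < b -> f a < f b.
Proof.
  intros H a b Ha Hab.
  destruct (MVT_gen f a b df) as [c [Hc E]];
    rewrite Rmin_left, Rmax_right in * by lra.
  - intros x Hx; apply H; lra.
  - intros x Hx. apply continuity_pt_filterlim.
    apply (ex_derive_continuous (K := R_AbsRing) (V := R_NormedModule)).
    exists (df x). apply H; lra.
  - assert (0 < df c * (b - a)); [|lra].
    apply Rmult_lt_0_compat; [apply H|]; lra.
Qed.

(** The mean value theorem on [[a, t]], with [a] tending to [0]: [h] is
    controlled at [0] through its one-sided limit alone. *)
Lemma mean_value_bound_from_0 (h dh : R -> R) (l eta t1 : R) :
  (forall t, 0 < t < t1 -> is_derive h t (dh t) /\ Rabs (dh t) <= eta) ->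
  filterlim h (at_right 0) (locally l) ->
  forall t, 0 < t < t1 -> Rabs (h t - l) <= eta * t.
Proof.
  intros Hd Hl t Ht.
  assert (Heta : 0 <= eta)
    by (apply Rle_trans with (2 := proj2 (Hd t Ht)); apply Rabs_pos).
  apply le_epsilon; intros e He.
  destruct (at_right_eps _ _ Hl e He) as [d [Hd0 Hd1]].
  set (a := Rmin (t / 2) (d / 2)).
  assert (Ha : 0 < a < t /\ a < d).
  { unfold a; generalize (Rmin_l (t/2) (d/2)) (Rmin_r (t/2) (d/2)).
    assert (0 < Rmin (t/2) (d/2)) by (apply Rmin_glb_lt; lra). lra. }
  destruct (MVT_gen h a t dh) as [c [Hc Heq]].
  - intros x; rewrite Rmin_left, Rmax_right by lra; intros Hx. apply Hd; lra.
  - intros x; rewrite Rmin_left, Rmax_right by lra; intros Hx.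
    apply continuity_pt_filterlim. apply (ex_derive_continuous (K := R_AbsRing) (V := R_NormedModule)).
    exists (dh x); apply Hd; lra.
  - rewrite Rmin_left, Rmax_right in Hc by lra.
    replace (h t - l) with ((h t - h a) + (h a - l)) by ring.
    apply Rle_trans with (1 := Rabs_triang _ _).
    apply Rplus_le_compat; [|left; apply Hd1; lra].
    rewrite Heq, Rabs_mult, (Rabs_pos_eq (t - a)) by lra.
    apply Rmult_le_compat; try apply Rabs_pos; try lra.
    apply Hd; lra.
Qed.

(** * One-sided derivatives at time 0 *)

Definition right_derivative (f : R -> R) (l : R) : Prop :=
  forall eps, 0 < eps -> exists d, 0 < d /\
    forall t, 0 < t < d -> Rabs (f t - f 0 - l * t) <= eps * t.

(** Extending a trace to negative times by its tangent turns a one-sided derivative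
    into a two-sided one, to which the ordinary chain rule applies. *)
Definition extend_linearly (f : R -> R) (l t : R) : R :=
  if Rle_dec 0 t then f t else f 0 + l * t.

Lemma extend_linearly_0 f l : extend_linearly f l 0 = f 0.
Proof. unfold extend_linearly. destruct (Rle_dec 0 0); lra. Qed.

Lemma is_derive_extend_linearly f l :
  right_derivative f l -> is_derive (extend_linearly f l) 0 l.
Proof.
  intros H. apply is_derive_Reals. intros eps Heps.
  destruct (H (eps / 2)) as [d [Hd Hf]]; [lra|].
  exists (mkposreal d Hd). intros h Hh Hhd. simpl in Hhd.
  rewrite Rplus_0_l. unfold extend_linearly at 2.
  destruct (Rle_dec 0 0) as [_|]; [|lra]. unfold extend_linearly.
  destruct (Rle_dec 0 h) as [Hp|Hn].
  - rewrite Rabs_pos_eq in Hhd by lra.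
    assert (E := Hf h ltac:(lra)).
    replace ((f h - f 0) / h - l) with ((f h - f 0 - l * h) / h) by (field; trivial).
    rewrite Rabs_div, (Rabs_pos_eq h) by lra.
    apply Rle_lt_trans with (eps / 2); [|lra]. apply Rle_div_l; lra.
  - replace ((f 0 + l * h - f 0) / h - l) with 0 by (field; trivial).
    rewrite Rabs_R0; trivial.
Qed.

Lemma derive_zero_of_zero_right (f : R -> R) (T l : R) :
  0 < T -> (forall t, 0 <= t < T -> f t = 0) -> is_derive f 0 l -> l = 0.
Proof.
  intros HT Hz D. apply is_derive_Reals in D.
  destruct (Req_dec l 0) as [|Hl]; trivial. exfalso.
  destruct (D (Rabs l)) as [d Hd]; [now apply Rabs_pos_lt|].
  assert (Hm : 0 < Rmin (d / 2) (T / 2)).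
  { apply Rmin_glb_lt; [destruct d; simpl|]; lra. }
  assert (Hm1 := Rmin_l (d / 2) (T / 2)). assert (Hm2 := Rmin_r (d / 2) (T / 2)).
  set (h := Rmin (d / 2) (T / 2)) in *.
  assert (E := Hd h ltac:(lra) ltac:(rewrite Rabs_pos_eq; lra)).
  rewrite (Hz (0 + h)), (Hz 0) in E by lra.
  replace ((0 - 0) / h - l) with (- l) in E by (field; lra).
  rewrite Rabs_Ropp in E. lra.
Qed.

(** * The equation of state and the Lorentz factor *)

Lemma W_sq v : -1 < v < 1 -> W v ^ 2 = / (1 - v ^ 2).
Proof.
  intros Hv. unfold W. rewrite <- Rsqr_pow2, Rsqr_div', Rsqr_1, Rsqr_sqrt by nra.
  unfold Rdiv; ring.
Qed.

Lemma one_minus_mul_pos a b : -1 < a < 1 -> -1 < b < 1 -> 0 < 1 - a * b.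
Proof. nra. Qed.

Section EquationOfState.
Variable p : R -> R.
Hypothesis Hp : equation_of_state p.

Lemma is_derive_p rho : 0 < rho -> is_derive p rho (Derive p rho).
Proof. intros H. apply Derive_correct. exact (eos_diff p Hp rho 1 H ltac:(lia)). Qed.

Lemma is_derive_p' rho : 0 < rho -> is_derive (Derive p) rho (Derive_n p 2 rho).
Proof. intros H. exact (Derive_correct _ _ (eos_diff p Hp rho 2 H ltac:(lia))). Qed.

Lemma cs_sq rho : 0 < rho -> cs p rho ^ 2 = Derive p rho.
Proof.
  intros H. unfold cs. rewrite pow2_sqrt; trivial.
  generalize (eos_causal p Hp rho H); lra.
Qed.

Lemma cs_bounds rho : 0 < rho -> 0 < cs p rho < 1.
Proof.
  intros H. generalize (eos_causal p Hp rho H); intros H1.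
  unfold cs; split; [apply sqrt_lt_R0; lra|].
  rewrite <- sqrt_1; apply sqrt_lt_1; lra.
Qed.

Lemma pressure_increasing a b : 0 < a -> a < b -> p a < p b.
Proof.
  apply increasing_of_derive_pos with (Derive p).
  intros x Hx; split; [now apply is_derive_p|apply (eos_causal p Hp x Hx)].
Qed.

(** The square of [T01 p rho (cs p rho)], the energy flux of a state moving at its
    own sound speed, in a form without square roots. *)
Definition sonic_flux_sq (rho : R) : R :=
  (rho + p rho) ^ 2 * Derive p rho / (1 - Derive p rho) ^ 2.

Lemma T01_alt rho w : -1 < w < 1 ->
  T01 p rho w = (rho + p rho) * (w / (1 - w ^ 2)).
Proof. intros Hw. unfold T01. rewrite W_sq by trivial. field. nra. Qed.

Lemma T11_alt rho w : -1 < w < 1 -> T11 p rho w = T01 p rho w * w + p rho.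
Proof. intros Hw. unfold T11, T01. rewrite W_sq by trivial. field. nra. Qed.

Lemma T01_odd rho w : T01 p rho (- w) = - T01 p rho w.
Proof. unfold T01, W. replace ((- w) ^ 2) with (w ^ 2) by ring. ring. Qed.

Lemma sonic_flux_sq_alt rho : 0 < rho ->
  sonic_flux_sq rho = T01 p rho (cs p rho) ^ 2.
Proof.
  intros H. assert (Hs := cs_bounds rho H).
  rewrite T01_alt by lra. unfold sonic_flux_sq.
  assert (Hc := eos_causal p Hp rho H).
  rewrite <- (cs_sq rho H) in *. field. lra.
Qed.

(** The logarithmic derivative of the sonic flux is, up to the positive factor
    [(1 + p') / (2 p' (1 - p'))], the quantity that genuine nonlinearity makes
    positive. *)
Lemma sonic_flux_sq_increasing a b :
  0 < a -> a < b -> sonic_flux_sq a < sonic_flux_sq b.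
Proof.
  apply increasing_of_derive_pos with
    (fun x => (x + p x) ^ 2 * (1 + Derive p x) / (1 - Derive p x) ^ 3
       * (Derive_n p 2 x + 2 * Derive p x * (1 - Derive p x) / (x + p x))).
  intros x Hx.
  assert (Hc := eos_causal p Hp x Hx). assert (Hn := eos_nonneg p Hp x Hx).
  assert (Hg := eos_nonlinear p Hp x Hx).
  split.
  - unfold sonic_flux_sq.
    assert (D1 := is_derive_p x Hx). assert (D2 := is_derive_p' x Hx).
    auto_derive.
    + repeat split; try (eexists; eassumption).
      apply (pow_nonzero (1 - Derive p x) 2); lra.
    + change (fun x : R => p x) with p.
      change (fun x : R => Derive p x) with (Derive p).
      rewrite (is_derive_unique _ _ _ D2).
      field; lra.
  - apply Rmult_lt_0_compat; [|lra].
    apply Rdiv_lt_0_compat; [|apply pow_lt; lra].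
    apply Rmult_lt_0_compat; [apply pow_lt|]; lra.
Qed.

End EquationOfState.

(** * The Hugoniot relation at a Lax shock *)

Section Hugoniot.
Variable p : R -> R.

(** The Rankine-Hugoniot conditions enter through their consequence
    jump(T01) ^ 2 = jump(T00) jump(T11), which is free of the shock speed and
    invariant under boosts; up to a positive factor the difference of its two
    sides is the relation between the relative velocity and [Phi ^ 2]. *)
Lemma relative_velocity_sq rho v rhob vb :
  -1 < v < 1 -> -1 < vb < 1 ->
  0 < (rho + p rhob) * (rhob + p rho) ->
  (T01 p rho v - T01 p rhob vb) ^ 2
    = (T00 p rho v - T00 p rhob vb) * (T11 p rho v - T11 p rhob vb) ->
  ((v - vb) / (1 - v * vb)) ^ 2
    = (p rho - p rhob) * (rho - rhob) / ((rho + p rhob) * (rhob + p rho)).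
Proof.
  intros Hv Hvb HE. unfold T01, T00, T11. rewrite !W_sq by assumption.
  intros H. assert (H1 := one_minus_mul_pos v vb Hv Hvb).
  assert (0 < 1 - v ^ 2) by nra. assert (0 < 1 - vb ^ 2) by nra.
  set (q := p rho) in *; set (qb := p rhob) in *.
  assert (Hid : (rho + qb) * (rhob + q) * (v - vb) ^ 2
    = (q - qb) * (rho - rhob) * (1 - v * vb) ^ 2).
  { apply Rminus_diag_uniq.
    match type of H with ?a = ?b =>
    transitivity ((1 - v ^ 2) * (1 - vb ^ 2) * (a - b)); [|rewrite H; ring] end.
    field; lra. }
  apply Rmult_eq_reg_r with ((rho + qb) * (rhob + q) * (1 - v * vb) ^ 2);
    [|apply Rgt_not_eq, Rmult_lt_0_compat; [|apply pow_lt]; trivial].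
  transitivity ((rho + qb) * (rhob + q) * (v - vb) ^ 2); [field; lra|].
  rewrite Hid; field. split; intros E; rewrite E in HE; lra.
Qed.

(** The velocity [v] seen from a frame moving at [sg]. *)
Definition boost (sg v : R) : R := (v - sg) / (1 - v * sg).

Lemma boost_bounds sg v : -1 < sg < 1 -> -1 < v < 1 -> -1 < boost sg v < 1.
Proof.
  intros Hs Hv. unfold boost. assert (H := one_minus_mul_pos v sg Hv Hs).
  split; [apply Rlt_div_r|apply Rlt_div_l]; nra.
Qed.

Lemma boost_lt sg v w : -1 < sg < 1 -> -1 < v < 1 -> -1 < w < 1 ->
  boost sg v < boost sg w -> v < w.
Proof.
  intros Hs Hv Hw. unfold boost.
  assert (H1 := one_minus_mul_pos v sg Hv Hs).
  assert (H2 := one_minus_mul_pos w sg Hw Hs).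
  intros H. destruct (Rlt_or_le v w) as [|Hle]; trivial. exfalso.
  assert ((w - sg) / (1 - w * sg) <= (v - sg) / (1 - v * sg)); [|lra].
  apply Rle_div_l; trivial.
  replace ((v - sg) / (1 - v * sg) * (1 - w * sg))
    with (((v - sg) * (1 - w * sg)) / (1 - v * sg)) by (field; lra).
  apply Rle_div_r; trivial.
  assert (0 <= (v - w) * (1 - sg ^ 2)) by (apply Rmult_le_pos; nra).
  lra.
Qed.

(** With [T01 - sg T00] and [T11 - sg T01], whose continuity is the
    Rankine-Hugoniot conditions, one forms the energy flux in the frame of the
    shock. *)
Lemma T01_boost rho v sg : -1 < v < 1 -> -1 < sg < 1 ->
  (T01 p rho v - sg * T00 p rho v) - sg * (T11 p rho v - sg * T01 p rho v)
  = (1 - sg ^ 2) * T01 p rho (boost sg v).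
Proof.
  intros Hv Hs. rewrite (T01_alt p rho (boost sg v)) by now apply boost_bounds.
  unfold T01, T00, T11, boost. rewrite W_sq by assumption.
  assert (H := one_minus_mul_pos v sg Hv Hs).
  assert (0 < 1 - v ^ 2) by nra. assert (0 < 1 - sg ^ 2) by nra.
  field. repeat split; try lra.
  replace ((1 - v * sg) ^ 2 - (v - sg) ^ 2) with ((1 - v ^ 2) * (1 - sg ^ 2)) by ring.
  nra.
Qed.

Lemma T11_boost rho v sg : -1 < v < 1 -> -1 < sg < 1 ->
  (T11 p rho v - sg * T01 p rho v) - sg * (T01 p rho v - sg * T00 p rho v)
  = (1 - sg ^ 2) * T11 p rho (boost sg v).
Proof.
  intros Hv Hs. assert (Hb := boost_bounds sg v Hs Hv).
  rewrite (T11_alt p rho (boost sg v)), (T01_alt p rho (boost sg v)) by trivial.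
  unfold T01, T00, T11, boost. rewrite W_sq by assumption.
  assert (H := one_minus_mul_pos v sg Hv Hs).
  assert (0 < 1 - v ^ 2) by nra. assert (0 < 1 - sg ^ 2) by nra.
  field. repeat split; try lra.
  replace ((1 - v * sg) ^ 2 - (v - sg) ^ 2) with ((1 - v ^ 2) * (1 - sg ^ 2)) by ring.
  nra.
Qed.

(** Since [T01] is [rho + p rho] times this expression, the energy flux increases
    with the velocity. *)
Lemma gamma_sq_mul_lt x y : -1 < x -> x < y -> y < 1 -> x / (1 - x ^ 2) < y / (1 - y ^ 2).
Proof.
  intros. assert (0 < 1 - x ^ 2) by nra. assert (0 < 1 - y ^ 2) by nra.
  apply Rlt_div_l; trivial.
  replace (y / (1 - y ^ 2) * (1 - x ^ 2)) with (y * (1 - x ^ 2) / (1 - y ^ 2)) by (field; lra).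
  apply Rlt_div_r; trivial.
  assert (0 < 1 + x * y) by nra. nra.
Qed.

Hypothesis Hp : equation_of_state p.

(** In the frame of the shock both fluids move to the left, supersonically ahead
    and subsonically behind, with the same energy flux.  Its size exceeds the
    sonic flux of the state ahead and falls short of that of the state behind,
    which orders the two densities.  As the momentum flux is [T01 * w + p] and
    [T01 < 0], the velocity then jumps in the same direction as the pressure. *)
Lemma shock_frame_compressive rho w rhob wb :
  0 < rho -> 0 < rhob -> -1 < w < 1 -> -1 < wb < 1 ->
  - cs p rho < w -> wb < - cs p rhob ->
  T01 p rho w = T01 p rhob wb ->
  T11 p rho w = T11 p rhob wb ->
  rhob < rho /\ wb < w.
Proof.
  intros Hr Hrb Hw Hwb Hlax Hlaxb Hm Hmom.
  assert (Hc := cs_bounds p Hp rho Hr). assert (Hcb := cs_bounds p Hp rhob Hrb).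
  assert (Hn := eos_nonneg p Hp rho Hr). assert (Hnb := eos_nonneg p Hp rhob Hrb).
  assert (H1 : T01 p rhob wb < - T01 p rhob (cs p rhob)).
  { rewrite <- T01_odd, !T01_alt by lra.
    apply Rmult_lt_compat_l; [lra|]. apply gamma_sq_mul_lt; lra. }
  assert (H2 : - T01 p rho (cs p rho) < T01 p rho w).
  { rewrite <- T01_odd, !T01_alt by lra.
    apply Rmult_lt_compat_l; [lra|]. apply gamma_sq_mul_lt; lra. }
  assert (H3 : 0 < T01 p rhob (cs p rhob)).
  { rewrite T01_alt by lra.
    apply Rmult_lt_0_compat; [lra|]. apply Rdiv_lt_0_compat; nra. }
  assert (Hrho : rhob < rho).
  { destruct (Rlt_or_le rhob rho) as [|[Hlt|Heq]]; trivial; exfalso.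
    - assert (H := sonic_flux_sq_increasing p Hp _ _ Hr Hlt).
      rewrite !(sonic_flux_sq_alt p Hp) in H by assumption. nra.
    - rewrite Heq in *. lra. }
  split; trivial.
  assert (Hpp := pressure_increasing p Hp _ _ Hrb Hrho).
  rewrite !T11_alt in Hmom by trivial.
  rewrite <- Hm in Hmom, H1. nra.
Qed.

(** Dividing the speeds by [sqrt (A * B)] reduces to special relativity; the Lax
    inequalities put the scaled shock speed in [(-1, 1)], so that one may pass
    to the frame of the shock. *)
Lemma Lax_shock_relative_velocity A B rho v rhob vb s :
  0 < A -> 0 < B -> admissible rho v -> admissible rhob vb ->
  sqrt (A * B) * T01 p rho v - sqrt (A * B) * T01 p rhob vb
    = s * (T00 p rho v - T00 p rhob vb) ->
  sqrt (A * B) * T11 p rho v - sqrt (A * B) * T11 p rhob vb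
    = s * (T01 p rho v - T01 p rhob vb) ->
  lambda_plus p A B rhob vb < s ->
  s < lambda_plus p A B rho v ->
  rhob < rho /\ (v - vb) / (1 - v * vb) = Phi p rho rhob.
Proof.
  intros HA HB [Hr Hv] [Hrb Hvb] RH0 RH1 L1 L2.
  assert (Hq : 0 < sqrt (A * B)) by (apply sqrt_lt_R0; nra).
  unfold lambda_plus in L1, L2. set (q := sqrt (A * B)) in *.
  assert (Hc := cs_bounds p Hp rho Hr). assert (Hcb := cs_bounds p Hp rhob Hrb).
  set (c := cs p rho) in *. set (cb := cs p rhob) in *.
  set (sg := s / q).
  assert (Es : s = q * sg) by (unfold sg; field; lra).
  rewrite Es in *. clearbody sg.
  assert (K1 : 0 < 1 + v * c) by nra. assert (K2 : 0 < 1 + vb * cb) by nra.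
  apply Rmult_lt_reg_l in L1; trivial. apply Rmult_lt_reg_l in L2; trivial.
  assert (Hsg : -1 < sg < 1).
  { split.
    - apply Rle_lt_trans with (2 := L1). apply Rle_div_r; trivial. nra.
    - apply Rlt_le_trans with (1 := L2). apply Rle_div_l; trivial. nra. }
  apply Rlt_div_l in L1; trivial. apply Rlt_div_r in L2; trivial.
  assert (RH0' : T01 p rho v - T01 p rhob vb = sg * (T00 p rho v - T00 p rhob vb))
    by (apply Rmult_eq_reg_l with q; lra).
  assert (RH1' : T11 p rho v - T11 p rhob vb = sg * (T01 p rho v - T01 p rhob vb))
    by (apply Rmult_eq_reg_l with q; lra).
  assert (Hn := eos_nonneg p Hp rho Hr). assert (Hnb := eos_nonneg p Hp rhob Hrb).
  assert (G1 := one_minus_mul_pos v sg Hv Hsg).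
  assert (G2 := one_minus_mul_pos vb sg Hvb Hsg).
  destruct (shock_frame_compressive rho (boost sg v) rhob (boost sg vb)) as [C1 C2];
    trivial; try now apply boost_bounds.
  - fold c. unfold boost. apply Rlt_div_r; trivial. nra.
  - fold cb. unfold boost. apply Rlt_div_l; trivial. nra.
  - apply Rmult_eq_reg_l with (1 - sg ^ 2); [|nra].
    rewrite <- !T01_boost by assumption. nra.
  - apply Rmult_eq_reg_l with (1 - sg ^ 2); [|nra].
    rewrite <- !T11_boost by assumption. nra.
  - split; trivial.
    apply boost_lt in C2; trivial.
    unfold Phi. rewrite <- (relative_velocity_sq rho v rhob vb); trivial.
    + rewrite sqrt_pow2; trivial. left; apply Rdiv_lt_0_compat; [lra|].
      now apply one_minus_mul_pos.
    + apply Rmult_lt_0_compat; lra.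
    + rewrite RH1', RH0'. ring.
Qed.

End Hugoniot.

(** * Differentiating the Hugoniot relation *)

Section PhiDerivatives.
Variable p : R -> R.
Hypothesis Hp : equation_of_state p.

(** The total derivative of [Phi] in the direction [(a, b)]; the partial derivatives
    are recovered by taking [(1, 0)] and [(0, 1)]. *)
Definition dPhi (rho rhob a b : R) : R :=
  (((Derive p rho * a - Derive p rhob * b) * (rho - rhob) + (p rho - p rhob) * (a - b))
     * ((rho + p rhob) * (rhob + p rho))
   - (p rho - p rhob) * (rho - rhob)
     * ((a + Derive p rhob * b) * (rhob + p rho) + (rho + p rhob) * (b + Derive p rho * a)))
  / ((rho + p rhob) * (rhob + p rho)) ^ 2 / (2 * Phi p rho rhob).

(** The ordering of the densities keeps the argument of the square root positive,
    away from the singularity of [Phi] on the diagonal. *)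
Lemma is_derive_Phi_along (x y : R -> R) (t a b : R) :
  0 < y t < x t -> is_derive x t a -> is_derive y t b ->
  is_derive (fun u => Phi p (x u) (y u)) t (dPhi (x t) (y t) a b).
Proof.
  intros H Dx Dy.
  assert (D1 := is_derive_p p Hp (x t) ltac:(lra)).
  assert (D2 := is_derive_p p Hp (y t) ltac:(lra)).
  assert (Hn1 := eos_nonneg p Hp (x t) ltac:(lra)).
  assert (Hn2 := eos_nonneg p Hp (y t) ltac:(lra)).
  assert (Hi := pressure_increasing p Hp (y t) (x t) ltac:(lra) ltac:(lra)).
  assert (HE : 0 < (x t + p (y t)) * (y t + p (x t)))
    by (apply Rmult_lt_0_compat; lra).
  assert (HN : 0 < (p (x t) - p (y t)) * (x t - y t) / ((x t + p (y t)) * (y t + p (x t)))).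
  { apply Rdiv_lt_0_compat; trivial. apply Rmult_lt_0_compat; lra. }
  assert (Hs := sqrt_lt_R0 _ HN).
  unfold dPhi, Phi in *. auto_derive.
  - repeat split; trivial; try (eexists; eassumption); lra.
  - change (fun u : R => x u) with x. change (fun u : R => y u) with y.
    change (fun u : R => p u) with p.
    rewrite (is_derive_unique _ _ _ Dx), (is_derive_unique _ _ _ Dy).
    set (z := sqrt _) in *. field.
    repeat split; lra.
Qed.

Lemma dPhi_partials rho rhob a b : 0 < rhob < rho ->
  dPhi rho rhob a b = Phi_rho p rho rhob * a + Phi_rhob p rho rhob * b.
Proof.
  intros H.
  assert (E1 : Phi_rho p rho rhob = dPhi rho rhob 1 0).
  { apply is_derive_unique, (is_derive_Phi_along (fun x => x) (fun _ => rhob)); trivial.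
    apply (is_derive_id (K := R_AbsRing)).
    apply (is_derive_const (K := R_AbsRing) (V := R_NormedModule)). }
  assert (E2 : Phi_rhob p rho rhob = dPhi rho rhob 0 1).
  { apply is_derive_unique, (is_derive_Phi_along (fun _ => rho) (fun x => x)); trivial.
    apply (is_derive_const (K := R_AbsRing) (V := R_NormedModule)).
    apply (is_derive_id (K := R_AbsRing)). }
  rewrite E1, E2. unfold dPhi, Rdiv. ring.
Qed.

End PhiDerivatives.

(** Replacing the four traces by their linear extensions makes both sides of the
    relation differentiable at [0]; the relation itself is known for
    nonnegative times only, which still determines the derivative. *)
Lemma Hugoniot_differentiated (p rl vl rr vr : R -> R) (T rl' vl' rr' vr' : R) :
  equation_of_state p -> 0 < T ->
  right_derivative rl rl' -> right_derivative vl vl' ->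
  right_derivative rr rr' -> right_derivative vr vr' ->
  0 < rr 0 < rl 0 -> -1 < vl 0 < 1 -> -1 < vr 0 < 1 ->
  (forall t, 0 <= t < T ->
     (vl t - vr t) / (1 - vl t * vr t) = Phi p (rl t) (rr t)) ->
  Phi_rho p (rl 0) (rr 0) * rl' + (vr 0 ^ 2 - 1) / (1 - vl 0 * vr 0) ^ 2 * vl'
  = (vl 0 ^ 2 - 1) / (1 - vl 0 * vr 0) ^ 2 * vr' - Phi_rhob p (rl 0) (rr 0) * rr'.
Proof.
  intros Hp HT Drl Dvl Drr Dvr Hrho Hvl Hvr Hrel.
  apply is_derive_extend_linearly in Drl, Dvl, Drr, Dvr.
  assert (Erl := extend_linearly_0 rl rl'). assert (Evl := extend_linearly_0 vl vl').
  assert (Err := extend_linearly_0 rr rr'). assert (Evr := extend_linearly_0 vr vr').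
  assert (Hrel' : forall t, 0 <= t < T ->
    (extend_linearly vl vl' t - extend_linearly vr vr' t)
      / (1 - extend_linearly vl vl' t * extend_linearly vr vr' t)
      - Phi p (extend_linearly rl rl' t) (extend_linearly rr rr' t) = 0).
  { intros t Ht. unfold extend_linearly. destruct (Rle_dec 0 t) as [|]; [|lra].
    rewrite Hrel by trivial. ring. }
  assert (H1 := one_minus_mul_pos _ _ Hvl Hvr).
  rewrite <- Erl, <- Evl, <- Err, <- Evr in *.
  revert Drl Dvl Drr Dvr Hrel' Hrho H1. clear - Hp HT.
  generalize (extend_linearly rl rl') (extend_linearly vl vl')
    (extend_linearly rr rr') (extend_linearly vr vr').
  clear rl vl rr vr. intros rl vl rr vr Drl Dvl Drr Dvr Hrel Hrho H1.
  assert (Dphi := is_derive_Phi_along p Hp rl rr 0 rl' rr' Hrho Drl Drr).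
  rewrite (dPhi_partials p Hp _ _ _ _ Hrho) in Dphi.
  assert (Dv : is_derive (fun t : R => (vl t - vr t) / (1 - vl t * vr t)) 0
    (((1 - vr 0 ^ 2) * vl' + (vl 0 ^ 2 - 1) * vr') / (1 - vl 0 * vr 0) ^ 2)).
  { auto_derive.
    - repeat split; try (eexists; eassumption). lra.
    - change (fun t : R => vl t) with vl. change (fun t : R => vr t) with vr.
      rewrite (is_derive_unique _ _ _ Dvl), (is_derive_unique _ _ _ Dvr). field. lra. }
  assert (Z : ((1 - vr 0 ^ 2) * vl' + (vl 0 ^ 2 - 1) * vr') / (1 - vl 0 * vr 0) ^ 2
      - (Phi_rho p (rl 0) (rr 0) * rl' + Phi_rhob p (rl 0) (rr 0) * rr') = 0).
  { apply (derive_zero_of_zero_right _ T _ HT Hrel).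
    exact (is_derive_minus (K := R_AbsRing) (V := R_NormedModule) _ _ _ _ _ Dv Dphi). }
  apply Rminus_diag_uniq. match type of Z with ?z = _ => transitivity (- z) end.
  - field. lra.
  - rewrite Z. ring.
Qed.

(** * Time derivatives of the traces along the shock *)

(** Openness of [D] makes the partial derivatives exist around the point, so that
    their continuity there gives differentiability and the chain rule. *)
Lemma C1_along_curve (D : R -> R -> Prop) (f : R -> R -> R) (x : R -> R) (t dx : R) :
  (forall t r, D t r -> locally_2d D t r) ->
  (forall t r, D t r -> C1_at f t r) ->
  D t (x t) -> is_derive x t dx ->
  is_derive (fun t' => f t' (x t')) t (d_t f t (x t) + d_r f t (x t) * dx).
Proof.
  intros Hopen HC HD Hx.
  destruct (HC _ _ HD) as [Ht [Hr [_ [Hct _]]]].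
  apply is_derive_Reals.
  replace (_ + _) with (d_t f t (x t) * 1 + d_r f t (x t) * dx) by ring.
  apply (derivable_pt_lim_comp_2d f (fun t' => t') x t).
  - apply filterdiff_differentiable_pt_lim.
    eapply filterdiff_ext_lin.
    + apply (is_derive_filterdiff f t (x t) (d_t f) (d_r f t (x t))).
      * apply (proj1 (locally_2d_locally
          (fun u w => is_derive (fun z => f z w) u (d_t f u w)) t (x t))).
        apply locally_2d_impl with (2 := Hopen _ _ HD).
        apply locally_2d_forall; intros u w Huw.
        apply Derive_correct, (HC _ _ Huw).
      * apply Derive_correct, Hr.
      * apply continuity_2d_pt_filterlim, Hct.
    + intros [u w]; reflexivity.
  - apply is_derive_Reals, (is_derive_id (K := R_AbsRing)).
  - apply is_derive_Reals, Hx.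
Qed.

(** Membership of the rays [x0 + th (x t - x0)] in [D] is uniform in [th] near [1]
    on the given side, so the slope estimate holds for every such ray on one
    common time interval; letting [th] tend to [1] at fixed [t] transfers it to the
    trace. *)
Lemma right_derivative_of_trace (D : R -> R -> Prop) (f : R -> R -> R)
    (side : R -> Prop) (x dx g : R -> R) (x0 T l ft fr : R) :
  (forall t r, D t r -> locally_2d D t r) ->
  (forall t r, D t r -> C1_at f t r) ->
  limit_from D 0 x0 f l ->
  limit_from D 0 x0 (d_t f) ft ->
  limit_from D 0 x0 (d_r f) fr ->
  0 < T ->
  filterlim x (at_right 0) (locally x0) ->
  (forall t, 0 < t < T -> is_derive x t (dx t)) ->
  filterlim dx (at_right 0) (locally (dx 0)) ->
  (exists e t1, 0 < e /\ 0 < t1 /\ forall th t, side th -> Rabs (th - 1) < e ->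
     0 < t < t1 -> D t (x0 + th * (x t - x0))) ->
  (forall t e eps, 0 < t < T -> 0 < e -> 0 < eps ->
     exists th, side th /\ Rabs (th - 1) < e /\
       Rabs (f t (x0 + th * (x t - x0)) - g t) < eps) ->
  g 0 = l ->
  right_derivative g (ft + dx 0 * fr).
Proof.
  intros Hopen HC Hl Hft Hfr HT Hx Hdx Hdx0 [e0 [t0 [He0 [Ht0 Hray]]]] Htr Hg0.
  intros eta Heta.
  set (K := Rabs (dx 0) + Rabs fr + 1).
  assert (HK : 1 <= K) by (unfold K; generalize (Rabs_pos (dx 0)) (Rabs_pos fr); lra).
  assert (HK2 : 1 <= K ^ 2) by nra.
  (* As z <= 1, the slopes dx and d_r f stay below K once within z of their limits.
     The slope along a ray then differs from its limit by four errors, each at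
     most z * K ^ 2. *)
  set (z := Rmin 1 (eta / (4 * K ^ 2))).
  assert (Hz : 0 < z /\ z <= 1 /\ z * K ^ 2 <= eta / 4).
  { unfold z; split; [apply Rmin_glb_lt; [lra|apply Rdiv_lt_0_compat; nra]|].
    split; [apply Rmin_l|].
    apply Rle_trans with (eta / (4 * K ^ 2) * K ^ 2).
    - apply Rmult_le_compat_r; [nra|apply Rmin_r].
    - right; field; lra. }
  destruct (limit_from_eps _ _ _ _ _ Hft z (proj1 Hz)) as [d1 [Hd1 Kt]].
  destruct (limit_from_eps _ _ _ _ _ Hfr z (proj1 Hz)) as [d2 [Hd2 Kr]].
  destruct (at_right_eps _ _ Hdx0 z (proj1 Hz)) as [d3 [Hd3 Ks]].
  set (d := Rmin d1 d2).
  assert (Hd : 0 < d /\ d <= d1 /\ d <= d2)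
    by (unfold d; repeat split; [apply Rmin_glb_lt; lra|apply Rmin_l|apply Rmin_r]).
  destruct (at_right_eps _ _ Hx (d / 2)) as [d4 [Hd4 Kx]]; [lra|].
  set (t1 := Rmin (Rmin t0 T) (Rmin d3 (Rmin d4 d))).
  assert (Ht1 : 0 < t1 /\ t1 <= t0 /\ t1 <= T /\ t1 <= d3 /\ t1 <= d4 /\ t1 <= d).
  { unfold t1. repeat split.
    - repeat apply Rmin_glb_lt; lra.
    - eapply Rle_trans; [apply Rmin_l|apply Rmin_l].
    - eapply Rle_trans; [apply Rmin_l|apply Rmin_r].
    - eapply Rle_trans; [apply Rmin_r|apply Rmin_l].
    - eapply Rle_trans; [apply Rmin_r|]. eapply Rle_trans; [apply Rmin_r|apply Rmin_l].
    - eapply Rle_trans; [apply Rmin_r|]. eapply Rle_trans; [apply Rmin_r|apply Rmin_r]. }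
  exists t1; split; [lra|]. intros t Ht. rewrite Hg0.
  apply le_epsilon; intros eps Heps.
  destruct (Htr t (Rmin e0 z) eps) as [th [Hside [Hth Hclose]]];
    [lra|apply Rmin_glb_lt; lra|lra|].
  assert (Hth0 : Rabs (th - 1) < e0) by (generalize (Rmin_l e0 z); lra).
  assert (Hthz : Rabs (th - 1) < z) by (generalize (Rmin_r e0 z); lra).
  set (c := fun u => x0 + th * (x u - x0)).
  assert (HD : forall u, 0 < u < t1 -> D u (c u))
    by (intros u Hu; apply Hray; trivial; lra).
  assert (Hc : forall u, 0 < u < t1 -> Rabs (u - 0) < d /\ Rabs (c u - x0) < d).
  { intros u Hu; split; [rewrite Rminus_0_r, Rabs_pos_eq; lra|].
    unfold c. replace (x0 + th * (x u - x0) - x0) with (th * (x u - x0)) by ring.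
    rewrite Rabs_mult.
    assert (Rabs th < 2).
    { apply Rabs_def1; apply Rabs_def2 in Hthz; lra. }
    assert (Rabs (x u - x0) < d / 2) by (apply Kx; lra).
    generalize (Rabs_pos th) (Rabs_pos (x u - x0)); nra. }
  set (L := ft + dx 0 * fr).
  assert (Hmain : Rabs ((f t (c t) - L * t) - l) <= eta * t).
  { apply (mean_value_bound_from_0 (fun u => f u (c u) - L * u)
      (fun u => (d_t f u (c u) + d_r f u (c u) * (th * dx u)) - L) l eta t1); trivial.
    - intros u Hu. split.
      + apply (is_derive_minus (K := R_AbsRing) (V := R_NormedModule)).
        * apply (C1_along_curve D f c u); auto.
          unfold c. evar_last.
          { apply (is_derive_plus (K := R_AbsRing) (V := R_NormedModule)).
            apply is_derive_const.
            apply is_derive_scal.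
            apply (is_derive_minus (K := R_AbsRing) (V := R_NormedModule)).
            apply Hdx; lra. apply is_derive_const. }
          unfold minus, plus, opp, zero; simpl; unfold plus; simpl; ring.
        * auto_derive; trivial; ring.
      + destruct (Hc u Hu) as [Hu1 Hu2].
        assert (E1 := Kt u (c u) ltac:(lra) ltac:(lra) (HD u Hu)).
        assert (E2 := Kr u (c u) ltac:(lra) ltac:(lra) (HD u Hu)).
        assert (E3 := Ks u ltac:(lra)).
        set (a := d_t f u (c u)) in *. set (b := d_r f u (c u)) in *.
        set (w := dx u) in *.
        replace (a + b * (th * w) - L) with
          ((a - ft) + ((th - 1) * (b * w) + ((b - fr) * w + fr * (w - dx 0))))
          by (unfold L; ring).
        assert (Hb : Rabs b <= K).
        { replace b with ((b - fr) + fr) by ring.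
          eapply Rle_trans; [apply Rabs_triang|].
          unfold K; generalize (Rabs_pos (dx 0)); lra. }
        assert (Hw : Rabs w <= K).
        { replace w with ((w - dx 0) + dx 0) by ring.
          eapply Rle_trans; [apply Rabs_triang|].
          unfold K; generalize (Rabs_pos fr); lra. }
        assert (Hfr' : Rabs fr <= K)
          by (unfold K; generalize (Rabs_pos (dx 0)); lra).
        repeat (eapply Rle_trans; [apply Rabs_triang|]).
        eapply Rle_trans; [apply Rplus_le_compat_l, Rabs_triang|].
        eapply Rle_trans; [apply Rplus_le_compat_l, Rplus_le_compat_l, Rabs_triang|].
        rewrite !Rabs_mult.
        assert (Rabs (th - 1) * (Rabs b * Rabs w) <= z * (K * K))
          by (repeat apply Rmult_le_compat; try apply Rmult_le_pos;
              try apply Rabs_pos; lra).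
        assert (Rabs (b - fr) * Rabs w <= z * K)
          by (apply Rmult_le_compat; try apply Rabs_pos; lra).
        assert (Rabs fr * Rabs (w - dx 0) <= K * z)
          by (apply Rmult_le_compat; try apply Rabs_pos; lra).
        assert (z <= z * K ^ 2) by nra. assert (z * K <= z * K ^ 2) by nra.
        replace (K * K) with (K ^ 2) in * by ring. lra.
    - replace l with (l - L * 0) by ring.
      apply (lim_minus (at_right 0) (fun u => f u (c u)) (fun u => L * u));
        [|apply (lim_mult (at_right 0) (fun _ => L) (fun u => u));
          [apply (lim_const (at_right 0))|]].
      + apply filterlim_locally; intros [e He].
        destruct (limit_from_eps _ _ _ _ _ Hl e He) as [d5 [Hd5 Kl]].
        destruct (at_right_eps _ _ Hx (d5 / 2)) as [d6 [Hd6 Kx6]]; [lra|].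
        assert (Hm : 0 < Rmin t1 (Rmin d5 d6)) by (repeat apply Rmin_glb_lt; lra).
        exists (mkposreal _ Hm). intros u Hu Hu0.
        change (Rabs (u - 0) < Rmin t1 (Rmin d5 d6)) in Hu.
        assert (Hu' : u < t1 /\ u < d5 /\ u < d6).
        { rewrite Rminus_0_r, Rabs_pos_eq in Hu by lra.
          generalize (Rmin_l t1 (Rmin d5 d6)) (Rmin_r t1 (Rmin d5 d6))
            (Rmin_l d5 d6) (Rmin_r d5 d6). lra. }
        apply (Kl u (c u)).
        * rewrite Rminus_0_r, Rabs_pos_eq; lra.
        * unfold c. replace (_ - x0) with (th * (x u - x0)) by ring.
          rewrite Rabs_mult.
          assert (Rabs th < 2) by (apply Rabs_def1; apply Rabs_def2 in Hthz; lra).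
          assert (Rabs (x u - x0) < d5 / 2) by (apply Kx6; lra).
          generalize (Rabs_pos th) (Rabs_pos (x u - x0)); nra.
        * apply HD; lra.
      + apply filterlim_filter_le_1 with (2 := filterlim_id _ _).
        apply filter_le_within. }
  replace (g t - l - L * t) with ((f t (c t) - L * t - l) + - (f t (c t) - g t)) by ring.
  eapply Rle_trans; [apply Rabs_triang|]. rewrite Rabs_Ropp.
  apply Rplus_le_compat; [exact Hmain|left; exact Hclose].
Qed.

Lemma trace_on_rays (f : R -> R) (P : R -> Prop) (sg x0 y l e eps : R) :
  Rabs sg = 1 -> (forall mu, 0 < mu -> P (y + sg * mu)) ->
  x0 < y -> filterlim f (within P (locally y)) (locally l) -> 0 < e -> 0 < eps ->
  exists mu, 0 < mu < e /\ Rabs (f (x0 + (1 + sg * mu) * (y - x0)) - l) < eps.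
Proof.
  intros Hsg HP Hy Hf He Heps.
  destruct (proj1 (filterlim_locally _ _) Hf (mkposreal eps Heps)) as [[d Hd] Hfd].
  set (mu := Rmin (e / 2) (d / 2 / (y - x0))).
  assert (Hmu : 0 < mu /\ mu <= e / 2 /\ mu * (y - x0) <= d / 2).
  { unfold mu; repeat split; [|apply Rmin_l|].
    - apply Rmin_glb_lt; [lra|]. apply Rdiv_lt_0_compat; lra.
    - apply Rle_div_r; [lra|apply Rmin_r]. }
  exists mu. split; [lra|].
  replace (x0 + (1 + sg * mu) * (y - x0)) with (y + sg * (mu * (y - x0))) by ring.
  assert (0 < mu * (y - x0)) by nra.
  apply (Hfd (y + sg * (mu * (y - x0)))); [|now apply HP].
  change (Rabs (y + sg * (mu * (y - x0)) - y) < d).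
  replace (y + sg * (mu * (y - x0)) - y) with (sg * (mu * (y - x0))) by ring.
  rewrite Rabs_mult, Hsg, Rabs_pos_eq; lra.
Qed.

Lemma left_trace_on_rays (f : R -> R) (x0 y l e eps : R) :
  x0 < y -> filterlim f (at_left y) (locally l) -> 0 < e -> 0 < eps ->
  exists th, th < 1 /\ Rabs (th - 1) < e /\ Rabs (f (x0 + th * (y - x0)) - l) < eps.
Proof.
  intros Hy Hf He Heps.
  destruct (trace_on_rays f (fun u => u < y) (-1) x0 y l e eps) as [mu [Hmu Hc]];
    trivial; [rewrite Rabs_left; lra|intros; lra|].
  exists (1 + -1 * mu). split; [lra|]. split; [apply Rabs_def1; lra|exact Hc].
Qed.

Lemma right_trace_on_rays (f : R -> R) (x0 y l e eps : R) :
  x0 < y -> filterlim f (at_right y) (locally l) -> 0 < e -> 0 < eps ->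
  exists th, 1 < th /\ Rabs (th - 1) < e /\ Rabs (f (x0 + th * (y - x0)) - l) < eps.
Proof.
  intros Hy Hf He Heps.
  destruct (trace_on_rays f (fun u => y < u) 1 x0 y l e eps) as [mu [Hmu Hc]];
    trivial; [apply Rabs_R1|intros; lra|].
  exists (1 + 1 * mu). split; [lra|]. split; [apply Rabs_def1; lra|exact Hc].
Qed.

Definition between (T : R) (a b : R -> R) (t r : R) : Prop :=
  0 < t < T /\ a t < r < b t.

Lemma between_open (T : R) (a b : R -> R) :
  (forall t, 0 < t < T -> continuous a t /\ continuous b t) ->
  forall t r, between T a b t r -> locally_2d (between T a b) t r.
Proof.
  intros Hc t r [Ht Hr]. destruct (Hc t Ht) as [Ca Cb].
  apply locally_2d_locally.
  assert (L1 : filterlim (fst : R * R -> R) (locally (t, r)) (locally t))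
    by apply (continuous_fst t r).
  assert (L2 : filterlim (snd : R * R -> R) (locally (t, r)) (locally r))
    by apply (continuous_snd t r).
  assert (La : filterlim (fun z : R * R => snd z - a (fst z)) (locally (t, r)) (locally (r - a t))).
  { apply (lim_minus (locally (t, r)) snd (fun z => a (fst z))); trivial.
    now apply (lim_comp (locally (t, r)) fst a t). }
  assert (Lb : filterlim (fun z : R * R => b (fst z) - snd z) (locally (t, r)) (locally (b t - r))).
  { apply (lim_minus (locally (t, r)) (fun z => b (fst z)) snd); trivial.
    now apply (lim_comp (locally (t, r)) fst b t). }
  assert (P1 := L1 _ (open_gt 0 t (proj1 Ht))).
  assert (P2 := L1 _ (open_lt T t (proj2 Ht))).
  assert (P3 := La _ (open_gt 0 (r - a t) ltac:(lra))).
  assert (P4 := Lb _ (open_gt 0 (b t - r) ltac:(lra))).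
  apply (filter_imp (fun z : R * R => (0 < fst z /\ fst z < T)
    /\ (0 < snd z - a (fst z) /\ 0 < b (fst z) - snd z))).
  - intros [t' r']; unfold between; simpl; lra.
  - repeat apply filter_and; assumption.
Qed.

(** * Space derivatives from the Einstein-Euler equations *)

Lemma is_derive_W_sq (y : R -> R) (u b : R) :
  -1 < y u < 1 -> is_derive y u b ->
  is_derive (fun x => W (y x) ^ 2) u (2 * y u * b / (1 - y u ^ 2) ^ 2).
Proof.
  intros Hy Dy.
  apply (is_derive_ext_loc (fun x => / (1 - y x ^ 2))).
  - assert (Hc : continuous y u).
    { apply (ex_derive_continuous (K := R_AbsRing) (V := R_NormedModule)). now exists b. }
    apply filter_imp with (fun x => -1 < y x < 1).
    + intros x Hx. now rewrite W_sq.
    + apply (Hc (fun w => -1 < w < 1)).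
      apply (open_and (fun w => -1 < w) (fun w => w < 1)); trivial;
        [apply open_gt|apply open_lt].
  - auto_derive.
    + repeat split; [now exists b|nra].
    + change (fun x : R => y x) with y. rewrite (is_derive_unique _ _ _ Dy).
      field. nra.
Qed.

Section StressDerivatives.
Variable p : R -> R.
Hypothesis Hp : equation_of_state p.
Variables (x y : R -> R) (u a b : R).
Hypothesis Hadm : admissible (x u) (y u).
Hypothesis Dx : is_derive x u a.
Hypothesis Dy : is_derive y u b.

Lemma is_derive_T00 :
  is_derive (fun z : R => T00 p (x z) (y z)) u
    ((1 + Derive p (x u)) * a / (1 - y u ^ 2)
     + (x u + p (x u)) * (2 * y u * b) / (1 - y u ^ 2) ^ 2 - Derive p (x u) * a).
Proof.
  destruct Hadm as [Hx Hy].
  assert (DP := is_derive_p p Hp (x u) Hx).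
  pose (g := fun z => W (y z) ^ 2).
  assert (DW : is_derive g u (2 * y u * b / (1 - y u ^ 2) ^ 2))
    by now apply is_derive_W_sq.
  assert (Eg : g u = / (1 - y u ^ 2)) by now apply W_sq.
  change (is_derive (fun z => (x z + p (x z)) * g z - p (x z)) u
    ((1 + Derive p (x u)) * a / (1 - y u ^ 2)
     + (x u + p (x u)) * (2 * y u * b) / (1 - y u ^ 2) ^ 2 - Derive p (x u) * a)).
  clearbody g. auto_derive.
  - repeat split; try (eexists; eassumption).
  - change (fun z : R => x z) with x. change (fun z : R => g z) with g.
    change (fun z : R => p z) with p.
    rewrite (is_derive_unique _ _ _ Dx), (is_derive_unique _ _ _ DW), Eg.
    field. nra.
Qed.

Lemma is_derive_T01 :
  is_derive (fun z : R => T01 p (x z) (y z)) u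
    ((1 + Derive p (x u)) * a * y u / (1 - y u ^ 2)
     + (x u + p (x u)) * (1 + y u ^ 2) * b / (1 - y u ^ 2) ^ 2).
Proof.
  destruct Hadm as [Hx Hy].
  assert (DP := is_derive_p p Hp (x u) Hx).
  pose (g := fun z => W (y z) ^ 2).
  assert (DW : is_derive g u (2 * y u * b / (1 - y u ^ 2) ^ 2))
    by now apply is_derive_W_sq.
  assert (Eg : g u = / (1 - y u ^ 2)) by now apply W_sq.
  change (is_derive (fun z => (x z + p (x z)) * g z * y z) u
    ((1 + Derive p (x u)) * a * y u / (1 - y u ^ 2)
     + (x u + p (x u)) * (1 + y u ^ 2) * b / (1 - y u ^ 2) ^ 2)).
  clearbody g. auto_derive.
  - repeat split; try (eexists; eassumption).
  - change (fun z : R => x z) with x. change (fun z : R => g z) with g.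
    change (fun z : R => p z) with p. change (fun z : R => y z) with y.
    rewrite (is_derive_unique _ _ _ Dx), (is_derive_unique _ _ _ Dy),
      (is_derive_unique _ _ _ DW), Eg.
    field. nra.
Qed.

Lemma is_derive_T11 :
  is_derive (fun z : R => T11 p (x z) (y z)) u
    ((y u ^ 2 + Derive p (x u)) * a / (1 - y u ^ 2)
     + (x u + p (x u)) * (2 * y u * b) / (1 - y u ^ 2) ^ 2).
Proof.
  destruct Hadm as [Hx Hy].
  assert (DP := is_derive_p p Hp (x u) Hx).
  pose (g := fun z => W (y z) ^ 2).
  assert (DW : is_derive g u (2 * y u * b / (1 - y u ^ 2) ^ 2))
    by now apply is_derive_W_sq.
  assert (Eg : g u = / (1 - y u ^ 2)) by now apply W_sq.
  change (is_derive (fun z => (x z * y z ^ 2 + p (x z)) * g z) u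
    ((y u ^ 2 + Derive p (x u)) * a / (1 - y u ^ 2)
     + (x u + p (x u)) * (2 * y u * b) / (1 - y u ^ 2) ^ 2)).
  clearbody g. auto_derive.
  - repeat split; try (eexists; eassumption).
  - change (fun z : R => x z) with x. change (fun z : R => g z) with g.
    change (fun z : R => p z) with p. change (fun z : R => y z) with y.
    rewrite (is_derive_unique _ _ _ Dx), (is_derive_unique _ _ _ Dy),
      (is_derive_unique _ _ _ DW), Eg.
    field. nra.
Qed.

End StressDerivatives.

(** The factor [sqrt (A * B)] in the flux is differentiated by the constraint
    equations for [M] and [B], so no derivative of the metric survives. *)
Lemma is_derive_sqrt_AB (kappa T0 T1 : R) (A B M : R -> R) (r : R) :
  0 < r -> 0 < A r -> 0 < B r ->
  locally r (fun x => A x = 1 - 2 * M x / x) ->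
  ex_derive M r -> Derive M r = 1 / 2 * kappa * r ^ 2 * T0 ->
  ex_derive B r ->
  1 / B r * Derive B r = (1 - A r) / (A r * r) + kappa * r / A r * T1 ->
  is_derive (fun x : R => sqrt (A x * B x)) r
    (sqrt (A r * B r) *
      ((1 - A r) / (A r * r) + kappa * r / (2 * A r) * (T1 - T0))).
Proof.
  intros Hr HA HB HAeq [m DM] EM DB EB.
  assert (EA : A r = 1 - 2 * M r / r) by exact (locally_singleton _ _ HAeq).
  assert (EM' := is_derive_unique _ _ _ DM). rewrite EM' in EM.
  assert (DA : is_derive A r ((1 - A r) / r - kappa * r * T0)).
  { apply (is_derive_ext_loc (fun x => 1 - 2 * M x / x)).
    - apply filter_imp with (2 := HAeq). intros x E. now rewrite E.
    - auto_derive.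
      + repeat split; [now exists m|lra].
      + change (fun x : R => M x) with M. rewrite EM', EM, EA. field. lra. }
  assert (EB' : Derive B r = B r * ((1 - A r) / (A r * r) + kappa * r / A r * T1)).
  { rewrite <- EB. field. lra. }
  assert (HAB : 0 < A r * B r) by nra.
  assert (Hs := sqrt_lt_R0 _ HAB).
  auto_derive.
  - repeat split; trivial. now exists ((1 - A r) / r - kappa * r * T0).
  - change (fun x : R => A x) with A. change (fun x : R => B x) with B.
    rewrite (is_derive_unique _ _ _ DA), EB'.
    assert (Hq := sqrt_sqrt (A r * B r) ltac:(lra)).
    apply Rmult_eq_reg_r with (sqrt (A r * B r)); [|lra].
    match goal with |- _ = ?s * ?c * ?s => replace (s * c * s) with ((s * s) * c) by ring end.
    rewrite Hq. field. lra.
Qed.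

(** [- Pi1] and [- Pi2] with shock speed [q] are the source terms that remain after
    solving for the space derivatives; [q] stands for [sqrt (A * B)]. *)
Definition spatial_derivatives_resolved (kappa : R) (p : R -> R)
    (q a r h w h_t h_r w_t w_r : R) : Prop :=
  q * (w ^ 2 - cs p h ^ 2) * h_r
    = - (w * (1 - cs p h ^ 2)) * h_t + (h + p h) * w_t - Pi1 kappa p q a r h w
  /\
  q * (w ^ 2 - cs p h ^ 2) * w_r
    = (1 - w ^ 2) ^ 2 * cs p h ^ 2 / (h + p h) * h_t
      - w * (1 - cs p h ^ 2) * w_t - Pi2 kappa p q a r h w.

(** Cramer's rule for the two equations in the unknowns [d_r rho] and [d_r v]: the
    determinant of the flux Jacobian is proportional to [v ^ 2 - cs ^ 2]. *)
Lemma einstein_euler_resolved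
    (kappa : R) (p : R -> R) (A B M rho v : R -> R -> R) (t r : R) :
  equation_of_state p -> 0 < r -> 0 < A t r -> 0 < B t r ->
  admissible (rho t r) (v t r) -> C1_at rho t r -> C1_at v t r ->
  locally r (fun x => A t x = 1 - 2 * M t x / x) ->
  einstein_euler_at kappa p A B M rho v t r ->
  spatial_derivatives_resolved kappa p (sqrt (A t r * B t r)) (A t r) r
    (rho t r) (v t r) (d_t rho t r) (d_r rho t r) (d_t v t r) (d_r v t r).
Proof.
  intros Hp Hr HA HB Hadm Crho Cv HAeq [E0 E1 DM EM DB EB].
  assert (Dq := is_derive_sqrt_AB kappa (T00 p (rho t r) (v t r))
    (T11 p (rho t r) (v t r)) (A t) (B t) (M t) r Hr HA HB HAeq DM EM DB EB).
  assert (Drt : is_derive (fun t' => rho t' r) t (d_t rho t r)) by apply Derive_correct, Crho.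
  assert (Drr : is_derive (rho t) r (d_r rho t r)) by apply Derive_correct, Crho.
  assert (Dvt : is_derive (fun t' => v t' r) t (d_t v t r)) by apply Derive_correct, Cv.
  assert (Dvr : is_derive (v t) r (d_r v t r)) by apply Derive_correct, Cv.
  assert (D00 := is_derive_T00 p Hp (fun t' => rho t' r) (fun t' => v t' r) t _ _ Hadm Drt Dvt).
  assert (D01 := is_derive_T01 p Hp (fun t' => rho t' r) (fun t' => v t' r) t _ _ Hadm Drt Dvt).
  assert (D01r := is_derive_T01 p Hp (rho t) (v t) r _ _ Hadm Drr Dvr).
  assert (D11r := is_derive_T11 p Hp (rho t) (v t) r _ _ Hadm Drr Dvr).
  rewrite (Derive_mult (fun x => sqrt (A t x * B t x))) in E0, E1;
    try (eexists; eassumption).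
  apply is_derive_unique in D00, D01, D01r, D11r, Dq.
  rewrite D00, D01r, Dq in E0. rewrite D01, D11r, Dq in E1.
  clear D00 D01 D01r D11r Drt Drr Dvt Dvr Dq DM EM DB EB HAeq.
  destruct Hadm as [Hh Hw].
  assert (Hn := eos_nonneg p Hp _ Hh).
  unfold S0, S1, T00, T01, T11 in E0, E1. rewrite !W_sq in E0, E1 by assumption.
  unfold spatial_derivatives_resolved, Pi1, Pi2. rewrite !(cs_sq p Hp) by assumption.
  set (h := rho t r) in *. set (w := v t r) in *. set (P := p h) in *.
  set (c2 := Derive p h) in *. set (a := A t r) in *.
  set (q := sqrt (a * B t r)) in *.
  clearbody h w P c2 q a.
  assert (0 < 1 - w ^ 2) by nra.
  (* These multipliers eliminate d_r v, respectively d_r rho, from the energy and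
     momentum equations. *)
  match type of E0 with ?l0 = ?r0 => match type of E1 with ?l1 = ?r1 =>
    assert (K1 : 2 * w * (l0 - r0) - (1 + w ^ 2) * (l1 - r1) = 0)
      by (rewrite E0, E1; ring);
    assert (K2 : - ((1 - w ^ 2) / (h + P))
        * ((w ^ 2 + c2) * (l0 - r0) - (1 + c2) * w * (l1 - r1)) = 0)
      by (rewrite E0, E1; ring)
  end end.
  clear E0 E1.
  split; apply Rminus_diag_uniq.
  - etransitivity; [|exact K1]. field. repeat split; lra.
  - etransitivity; [|exact K2]. field. repeat split; lra.
Qed.

Lemma corner_resolved (kappa : R) (p : R -> R) (A B M rho v : R -> R -> R)
    (D : R -> R -> Prop) (r0 T : R) (j : jet) :
  equation_of_state p -> 0 < r0 -> 0 < T ->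
  smooth_region kappa p A B M rho v D ->
  corner_limits r0 D rho v j ->
  (forall t, 0 < t < T -> D t r0) ->
  (forall t, 0 <= t < T -> 0 < A t r0 /\ 0 < B t r0) ->
  (forall t, 0 < t < T -> locally r0 (fun x => A t x = 1 - 2 * M t x / x)) ->
  filterlim (fun t => A t r0) (at_right 0) (locally (A 0 r0)) ->
  filterlim (fun t => B t r0) (at_right 0) (locally (B 0 r0)) ->
  spatial_derivatives_resolved kappa p (sqrt (A 0 r0 * B 0 r0)) (A 0 r0) r0
    (j_rho j) (j_v j) (j_rho_t j) (j_rho_r j) (j_v_t j) (j_v_r j).
Proof.
  intros Hp Hr0 HT HS HC HD HAB HM LA LB.
  destruct HC as [[Hh Hw] Lh Lw Lht Lhr Lwt Lwr].
  apply (limit_from_vertical _ _ _ _ _ HT HD) in Lh, Lw, Lht, Lhr, Lwt, Lwr.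
  destruct (HAB 0 ltac:(lra)) as [HA HB].
  set (h := j_rho j) in *.
  assert (Hn := eos_nonneg p Hp _ Hh).
  assert (Lp : filterlim (fun t => p (rho t r0)) (at_right 0) (locally (p h))).
  { apply (lim_comp (at_right 0)); trivial.
    apply (ex_derive_continuous (K := R_AbsRing) (V := R_NormedModule)).
    exists (Derive p h). now apply is_derive_p. }
  assert (Lc : filterlim (fun t => cs p (rho t r0)) (at_right 0) (locally (cs p h))).
  { apply (lim_comp (at_right 0)); trivial. unfold cs.
    apply (continuous_comp (Derive p) sqrt).
    - apply (ex_derive_continuous (K := R_AbsRing) (V := R_NormedModule)).
      exists (Derive_n p 2 h). now apply is_derive_p'.
    - apply continuous_sqrt. }
  assert (Lq : filterlim (fun t => sqrt (A t r0 * B t r0)) (at_right 0)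
      (locally (sqrt (A 0 r0 * B 0 r0)))).
  { apply (lim_comp (at_right 0) (fun t => A t r0 * B t r0)); [|apply continuous_sqrt].
    now apply (lim_mult (at_right 0)). }
  assert (Heq : at_right 0 (fun t =>
    spatial_derivatives_resolved kappa p (sqrt (A t r0 * B t r0)) (A t r0) r0
      (rho t r0) (v t r0) (d_t rho t r0) (d_r rho t r0) (d_t v t r0) (d_r v t r0))).
  { exists (mkposreal T HT). intros t Ht Ht0.
    change (Rabs (t - 0) < T) in Ht. rewrite Rminus_0_r, Rabs_pos_eq in Ht by lra.
    assert (Ht' : 0 < t < T) by lra. assert (HDt := HD t Ht').
    destruct (HAB t ltac:(lra)). destruct HS as [S1 S2 S3 S4].
    apply einstein_euler_resolved with M; auto. }
  unfold spatial_derivatives_resolved, Pi1, Pi2, Rdiv in *.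
  split.
  - eapply (lim_eq (at_right 0));
      [apply filter_imp with (2 := Heq); intros t [E _]; exact E| |];
      lim (at_right 0); try eassumption; lra.
  - eapply (lim_eq (at_right 0));
      [apply filter_imp with (2 := Heq); intros t [_ E]; exact E| |];
      lim (at_right 0); try eassumption; lra.
Qed.

Theorem theorem3p2
    (kappa : R) (p : R -> R) (A B M rho v : R -> R -> R)
    (r0 T delta : R) (UL UR UL' UR' : R * R)
    (X : R -> R -> R) (rs s rhol vl rhor vr : R -> R) (jL jS jR : jet)
    (Hp : equation_of_state p) (Hr0 : 0 < r0)
    (HU : GRP_solution kappa p A B M rho v r0 T delta UL UR UL' UR'
            X rs s rhol vl rhor vr jL jS jR) :
  let A_s := A 0 r0 in
  let B_s := B 0 r0 in
  let s_s := s 0 in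
  let rho_s := j_rho jS in
  let v_s := j_v jS in
  let p_s := p rho_s in
  let cs_s := cs p rho_s in
  let rho_R := j_rho jR in
  let v_R := j_v jR in
  let a_R :=
    Phi_rho p rho_s rho_R
      * (v_s ^ 2 - cs_s ^ 2 - s_s * v_s * (1 - cs_s ^ 2) / sqrt (A_s * B_s))
    + (v_R ^ 2 - 1) / (1 - v_s * v_R) ^ 2
      * (s_s * (1 - v_s ^ 2) ^ 2 * cs_s ^ 2
         / (sqrt (A_s * B_s) * (rho_s + p_s))) in
  let b_R :=
    Phi_rho p rho_s rho_R * (s_s * (rho_s + p_s) / sqrt (A_s * B_s))
    + (v_R ^ 2 - 1) / (1 - v_s * v_R) ^ 2
      * (v_s ^ 2 - cs_s ^ 2 - s_s * v_s * (1 - cs_s ^ 2) / sqrt (A_s * B_s)) in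
  let d_R :=
    Phi_rho p rho_s rho_R * Pi1 kappa p s_s A_s r0 rho_s v_s
    + (v_R ^ 2 - 1) / (1 - v_s * v_R) ^ 2
      * Pi2 kappa p s_s A_s r0 rho_s v_s
    + (v_s ^ 2 - cs_s ^ 2)
      * ((v_s ^ 2 - 1) / (1 - v_s * v_R) ^ 2 * Ds_v s_s jR
         - Phi_rhob p rho_s rho_R * Ds_rho s_s jR) in
  a_R * j_rho_t jS + b_R * j_v_t jS = d_R.
Proof.
  intros A_s B_s s_s rho_s v_s p_s cs_s rho_R v_R a_R b_R d_R.
  destruct HU as [betaL betaS dom leftreg behind ahead HT Hdel HApos HBpos HAlip HBlip
    HM _ _ _ _ Hord _ _ Hfan Hbeh HbehL Hsh Hahd HahdL].
  clear leftreg.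
  assert (Crs : forall t, 0 < t < T -> continuous rs t).
  { intros t Ht. apply (ex_derive_continuous (K := R_AbsRing) (V := R_NormedModule)).
    exists (s t). apply (sh_speed _ _ _ _ _ _ _ _ _ _ _ _ _ _ _ Hsh t Ht). }
  assert (CX : forall t, 0 < t < T -> continuous (X betaS) t).
  { intros t Ht. apply (ex_derive_continuous (K := R_AbsRing) (V := R_NormedModule)).
    eexists. apply (rf_char _ _ _ _ _ _ _ _ _ _ _ _ Hfan); trivial.
    assert (H := rf_slopes _ _ _ _ _ _ _ _ _ _ _ _ Hfan). lra. }
  assert (Obeh : forall t r, behind t r -> locally_2d behind t r)
    by exact (between_open T (X betaS) rs (fun t Ht => conj (CX t Ht) (Crs t Ht))).
  assert (Oahd : forall t r, ahead t r -> locally_2d ahead t r)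
    by exact (between_open T rs (fun _ => r0 + delta)
      (fun t Ht => conj (Crs t Ht) (continuous_const _ _))).
  destruct Hsh as [[Hrs0 Lrs] Hspeed Ls Hspos Htr [Erl [Evl [Err Evr]]] Hadm RH0 RH1 HLax].
  assert (Drs : forall t, 0 < t < T -> is_derive rs t (s t)) by apply Hspeed.
  (* Since X betaS t < r0 < rs t, every ray with 0 < th < 1 lies between the fan
     and the shock. *)
  assert (RayBeh : exists e t1, 0 < e /\ 0 < t1 /\ forall th t, th < 1 ->
     Rabs (th - 1) < e -> 0 < t < t1 -> behind t (r0 + th * (rs t - r0))).
  { exists 1, T. repeat split; try lra; apply Rabs_def2 in H0;
      specialize (Hord t ltac:(lra)); nra. }
  assert (RayAhd : exists e t1, 0 < e /\ 0 < t1 /\ forall th t, 1 < th ->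
     Rabs (th - 1) < e -> 0 < t < t1 -> ahead t (r0 + th * (rs t - r0))).
  { destruct (at_right_eps _ _ Lrs (delta / 2)) as [d [Hd Hrsd]]; [lra|].
    exists 1, (Rmin d T). split; [lra|]. split; [apply Rmin_glb_lt; lra|].
    intros th t Hth1 Hth2 Ht. apply Rabs_def2 in Hth2.
    generalize (Rmin_l d T) (Rmin_r d T); intros M1 M2.
    assert (Hd' := Rabs_def2 _ _ (Hrsd t ltac:(lra))).
    specialize (Hord t ltac:(lra)).
    split; [lra|split; nra]. }
  assert (Drl : right_derivative rhol (Ds_rho (s 0) jS)).
  { apply (right_derivative_of_trace behind rho (fun th => th < 1) rs s rhol r0 T (j_rho jS));
      trivial; try apply Hbeh; try apply HbehL.
    intros t e eps Ht He Heps. apply left_trace_on_rays; trivial;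
      [apply (Hord t Ht)|apply (Htr t Ht)]. }
  assert (Dvl : right_derivative vl (Ds_v (s 0) jS)).
  { apply (right_derivative_of_trace behind v (fun th => th < 1) rs s vl r0 T (j_v jS));
      trivial; try apply Hbeh; try apply HbehL.
    intros t e eps Ht He Heps. apply left_trace_on_rays; trivial;
      [apply (Hord t Ht)|apply (Htr t Ht)]. }
  assert (Drr : right_derivative rhor (Ds_rho (s 0) jR)).
  { apply (right_derivative_of_trace ahead rho (fun th => 1 < th) rs s rhor r0 T (j_rho jR));
      trivial; try apply Hahd; try apply HahdL.
    intros t e eps Ht He Heps. apply right_trace_on_rays; trivial;
      [apply (Hord t Ht)|apply (Htr t Ht)]. }
  assert (Dvr : right_derivative vr (Ds_v (s 0) jR)).
  { apply (right_derivative_of_trace ahead v (fun th => 1 < th) rs s vr r0 T (j_v jR));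
      trivial; try apply Hahd; try apply HahdL.
    intros t e eps Ht He Heps. apply right_trace_on_rays; trivial;
      [apply (Hord t Ht)|apply (Htr t Ht)]. }
  assert (Hrel : forall t, 0 <= t < T -> rhor t < rhol t /\
    (vl t - vr t) / (1 - vl t * vr t) = Phi p (rhol t) (rhor t)).
  { intros t Ht. destruct (Hadm t Ht) as [Al Ar]. destruct (HLax t Ht) as [L1 [L2 _]].
    assert (Hin : dom t (rs t)).
    { split; trivial. destruct (Req_dec t 0) as [->|Hn].
      - rewrite Hrs0, Rminus_diag, Rabs_R0; lra.
      - specialize (Hord t ltac:(lra)). apply Rabs_def1; lra. }
    apply (Lax_shock_relative_velocity p Hp (A t (rs t)) (B t (rs t)) _ _ _ _ (s t));
      auto. }
  assert (Hshock : Phi_rho p rho_s rho_R * Ds_rho s_s jS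
      + (v_R ^ 2 - 1) / (1 - v_s * v_R) ^ 2 * Ds_v s_s jS
    = (v_s ^ 2 - 1) / (1 - v_s * v_R) ^ 2 * Ds_v s_s jR
      - Phi_rhob p rho_s rho_R * Ds_rho s_s jR).
  { unfold rho_s, rho_R, v_s, v_R, s_s. rewrite <- Erl, <- Evl, <- Err, <- Evr.
    destruct (Hadm 0 ltac:(lra)) as [[] []]. destruct (Hrel 0 ltac:(lra)).
    apply (Hugoniot_differentiated p rhol vl rhor vr T); trivial; [lra|].
    intros t Ht. apply (Hrel t Ht). }
  assert (Hres : spatial_derivatives_resolved kappa p (sqrt (A_s * B_s)) A_s r0
    rho_s v_s (j_rho_t jS) (j_rho_r jS) (j_v_t jS) (j_v_r jS)).
  { assert (Hin : forall t, 0 <= t < T -> dom t r0).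
    { intros t Ht. unfold dom. rewrite Rminus_diag, Rabs_R0. lra. }
    apply (corner_resolved kappa p A B M rho v behind r0 T jS); trivial.
    - intros t Ht. specialize (Hord t Ht). unfold behind. lra.
    - intros t Ht. auto.
    - intros t Ht. exists (mkposreal delta (proj1 Hdel)). intros x Hx.
      apply HM. split; [lra|exact Hx].
    - eapply lipschitz_vertical; [exact HT| |exact HAlip]; exact Hin.
    - eapply lipschitz_vertical; [exact HT| |exact HBlip]; exact Hin. }
  destruct HbehL as [[Hrho Hv] _ _ _ _ _ _].
  assert (HA0 : 0 < A_s).
  { apply HApos. unfold dom; rewrite Rminus_diag, Rabs_R0; lra. }
  assert (Hq : 0 < sqrt (A_s * B_s)).
  { apply sqrt_lt_R0, Rmult_lt_0_compat; trivial. apply HBpos.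
    unfold dom; rewrite Rminus_diag, Rabs_R0; lra. }
  assert (Hn := eos_nonneg p Hp _ Hrho).
  destruct Hres as [R1 R2]. unfold Ds_rho at 1, Ds_v at 1 in Hshock.
  unfold a_R, b_R, d_R. rewrite <- Hshock.
  unfold Pi1, Pi2 in *. fold cs_s p_s in R1, R2 |- *.
  fold rho_s in Hrho, Hn. fold p_s in Hn.
  set (q := sqrt (A_s * B_s)) in *.
  set (al := Phi_rho p rho_s rho_R). set (be := (v_R ^ 2 - 1) / (1 - v_s * v_R) ^ 2).
  (* Grouping the space derivatives with the factor q (v ^ 2 - cs ^ 2) makes the
     resolved equations R1 and R2 applicable; v ^ 2 = cs ^ 2 is not excluded. *)
  match goal with |- _ = ?x + ?y + _ =>
  transitivity (x + y + (v_s ^ 2 - cs_s ^ 2) * (al * j_rho_t jS + be * j_v_t jS)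
    + s_s / q * (al * (q * (v_s ^ 2 - cs_s ^ 2) * j_rho_r jS)
                 + be * (q * (v_s ^ 2 - cs_s ^ 2) * j_v_r jS)));
    [rewrite R1, R2|] end.
  - clearbody al be. field. repeat split; lra.
  - field. repeat split; lra.
Qed.
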